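(* Let $R$ be an arbitrary ring. Let $D_A:\mathrm{fp}(R\text{-}\mathrm{Mod},\mathrm{Ab})\to(\mathrm{mod}\text{-}R,\mathrm{Ab})^{\mathrm{op}}$ be the Auslander-Gruson-Jensen functor and let $D_L:(\mathrm{mod}\text{-}R,\mathrm{Ab})^{\mathrm{op}}\to\mathrm{fp}(R\text{-}\mathrm{Mod},\mathrm{Ab})$ be the functor $D_L=L_0(Y\circ\mathrm{ev}_R^{\mathrm{op}})$ defined in the context. Then $D_L\dashv D_A$. That is, for functors $F\in\mathrm{fp}(R\text{-}\mathrm{Mod},\mathrm{Ab})$ and $G\in(\mathrm{mod}\text{-}R,\mathrm{Ab})$, there is an isomorphism $$(D_LG,F)\cong(D_AF,G)$$ which is natural in $F$ and $G$.
   Context: All categories and functors are additive. $R\text{-}\mathrm{Mod}$ is the category of left $R$-modules and $\mathrm{mod}\text{-}R$ is the category of finitely presented right $R$-modules. $(X,-)$ denotes the representable (Hom) functor and $(F,G)$ denotes the group of natural transformations $F\to G$; $\otimes=\otimes_R$. $\mathrm{fp}(R\text{-}\mathrm{Mod},\mathrm{Ab})$ is the (abelian) category of finitely presented functors, i.e. additive functors $F:R\text{-}\mathrm{Mod}\to\mathrm{Ab}$ for which there is an exact sequence $(Y,-)\to(X,-)\to F\to0$ with $X,Y\in R\text{-}\mathrm{Mod}$. $(\mathrm{mod}\text{-}R,\mathrm{Ab})$ is the (abelian) category of all additive functors $\mathrm{mod}\text{-}R\to\mathrm{Ab}$. The functor $D_A$ is defined by $(D_AF)M=(F,M\otimes-)$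 for $F\in\mathrm{fp}(R\text{-}\mathrm{Mod},\mathrm{Ab})$ and $M\in\mathrm{mod}\text{-}R$, where $M\otimes-:R\text{-}\mathrm{Mod}\to\mathrm{Ab}$. The functor $D_L$ is $L_0(Y\circ\mathrm{ev}_R^{\mathrm{op}})$, the $0$-th left derived functor of $Y\circ\mathrm{ev}_R^{\mathrm{op}}:(\mathrm{mod}\text{-}R,\mathrm{Ab})^{\mathrm{op}}\to\mathrm{fp}(R\text{-}\mathrm{Mod},\mathrm{Ab})$, where $\mathrm{ev}_R:(\mathrm{mod}\text{-}R,\mathrm{Ab})\to R\text{-}\mathrm{Mod}$, $F\mapsto F(R_R)$, is evaluation at the ring and $Y:(R\text{-}\mathrm{Mod})^{\mathrm{op}}\to\mathrm{fp}(R\text{-}\mathrm{Mod},\mathrm{Ab})$, $X\mapsto(X,-)$, is the Yoneda embedding. The injective objects of $(\mathrm{mod}\text{-}R,\mathrm{Ab})$ are, up to isomorphism, the functors $-\otimes U$ with $U$ a pure-injective left $R$-module (Gruson-Jensen), so $D_L$ is the unique right exact functor agreeing with $-\otimes U\mapsto(U,-)$ on injectives: if $0\to G\to-\otimes U\to-\otimes V$ is exact with $U,V$ pure-injective, then $D_LG$ is the cokernel of the induced map $(V,-)\to(U,-)$. *)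

(* Defs.v *)
From HB Require Import structures.
From mathcomp Require Import all_boot all_algebra.
From mathcomp Require Import boolp classical_sets.
From mathcomp Require Import freeg.

Set Implicit Arguments.
Unset Strict Implicit.
Unset Printing Implicit Defensive.

Import GRing.Theory Num.Theory.
Local Open Scope ring_scope.

(* The hom-groups are not [zmodType]s because natural transformations between
   functors on R-Mod form a type that is too large to carry one. *)
Record preadditive := Preadditive {
  obj :> Type;
  hom : obj -> obj -> Type;
  idm : forall X, hom X X;
  cmp : forall X Y Z, hom Y Z -> hom X Y -> hom X Z;
  hzero : forall X Y, hom X Y;
  hopp : forall X Y, hom X Y -> hom X Y;
  hadd : forall X Y, hom X Y -> hom X Y -> hom X Y;
  cmp1m : forall X Y (f : hom X Y), cmp (idm Y) f = f;
  cmpm1 : forall X Y (f : hom X Y), cmp f (idm X) = f;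
  cmpA : forall X Y Z W (h : hom Z W) (g : hom Y Z) (f : hom X Y),
    cmp h (cmp g f) = cmp (cmp h g) f;
  haddA : forall X Y, associative (@hadd X Y);
  haddC : forall X Y, commutative (@hadd X Y);
  hadd0 : forall X Y, left_id (@hzero X Y) (@hadd X Y);
  haddN : forall X Y, left_inverse (@hzero X Y) (@hopp X Y) (@hadd X Y);
  cmpDl : forall X Y Z (g h : hom Y Z) (f : hom X Y),
    cmp (hadd g h) f = hadd (cmp g f) (cmp h f);
  cmpDr : forall X Y Z (h : hom Y Z) (f g : hom X Y),
    cmp h (hadd f g) = hadd (cmp h f) (cmp h g)
}.
Arguments hom {p}.
Arguments idm {p} X.
Arguments cmp {p X Y Z}.
Arguments hzero {p X Y}.
Arguments hopp {p X Y}.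
Arguments hadd {p X Y}.

Notation "g ∘ f" := (cmp g f) (at level 40, left associativity).

Section PreadditiveTheory.
Variable C : preadditive.
Implicit Types X Y Z W : C.

Lemma haddI X Y (f g h : hom X Y) : hadd f g = hadd f h -> g = h.
Proof.
by move=> e; rewrite -(hadd0 g) -(haddN f) -haddA e haddA haddN hadd0.
Qed.

Lemma hadd_eq0 X Y (f g : hom X Y) : hadd f (hopp g) = hzero -> f = g.
Proof.
by move=> e; apply: (@haddI _ _ (hopp g)); rewrite haddN haddC.
Qed.

Lemma cmp0m X Y Z (f : hom X Y) : (hzero : hom Y Z) ∘ f = hzero.
Proof.
by apply: (@haddI _ _ (hzero ∘ f)); rewrite -cmpDl hadd0 [RHS]haddC hadd0.
Qed.

Lemma cmpm0 X Y Z (f : hom Y Z) : f ∘ (hzero : hom X Y) = hzero.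
Proof.
by apply: (@haddI _ _ (f ∘ hzero)); rewrite -cmpDr hadd0 [RHS]haddC hadd0.
Qed.

Lemma haddrN X Y (f : hom X Y) : hadd f (hopp f) = hzero.
Proof. by rewrite haddC haddN. Qed.

Lemma cmpNm X Y Z (g : hom Y Z) (f : hom X Y) : hopp g ∘ f = hopp (g ∘ f).
Proof.
by apply: (@haddI _ _ (g ∘ f)); rewrite -cmpDl !haddrN cmp0m.
Qed.

Lemma cmpmN X Y Z (g : hom Y Z) (f : hom X Y) : g ∘ hopp f = hopp (g ∘ f).
Proof.
by apply: (@haddI _ _ (g ∘ f)); rewrite -cmpDr !haddrN cmpm0.
Qed.

Definition monic X Y (f : hom X Y) : Prop :=
  forall Z (u v : hom Z X), f ∘ u = f ∘ v -> u = v.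

Definition epic X Y (f : hom X Y) : Prop :=
  forall Z (u v : hom Y Z), u ∘ f = v ∘ f -> u = v.

Definition is_kernel X Y K (f : hom X Y) (k : hom K X) : Prop :=
  f ∘ k = hzero /\
  forall Z (z : hom Z X), f ∘ z = hzero -> exists! u : hom Z K, k ∘ u = z.

Definition is_cokernel X Y K (f : hom X Y) (q : hom Y K) : Prop :=
  q ∘ f = hzero /\
  forall Z (z : hom Y Z), z ∘ f = hzero -> exists! u : hom K Z, u ∘ q = z.

(* im f = ker g, in the abelian sense: f is an epimorphism onto a kernel of g *)
Definition exact_at X Y Z (f : hom X Y) (g : hom Y Z) : Prop :=
  exists (K : C) (k : hom K Y) (e : hom X K),
    [/\ is_kernel g k, epic e & f = k ∘ e].

Definition projective (P : C) : Prop :=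
  forall X Y (e : hom X Y), epic e ->
  forall g : hom P Y, exists h : hom P X, e ∘ h = g.

Record cokernel X Y (f : hom X Y) := Cokernel {
  coker_ob : C;
  coker_pr : hom Y coker_ob;
  coker_prP : is_cokernel f coker_pr
}.

Lemma is_cokernel_epic X Y K (f : hom X Y) (q : hom Y K) :
  is_cokernel f q -> epic q.
Proof.
move=> [qf0 univ] Z u v uv.
have [|w [_ wu]] := univ _ (u ∘ q); first by rewrite -cmpA qf0 cmpm0.
by rewrite -(wu u) // -(wu v).
Qed.

(* the beginning P1 -> P0 -> X -> 0 of a projective resolution of X *)
Record proj_presentation (X : C) := ProjPresentation {
  pres1 : C;
  pres0 : C;
  pres_d : hom pres1 pres0;
  pres_aug : hom pres0 X;
  pres1P : projective pres1;
  pres0P : projective pres0;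
  pres_exact : exact_at pres_d pres_aug;
  pres_augP : epic pres_aug
}.

End PreadditiveTheory.

Definition opcat (C : preadditive) : preadditive :=
  @Preadditive C (fun X Y => hom Y X) (@idm C) (fun X Y Z g f => f ∘ g)
    (fun X Y => @hzero C Y X) (fun X Y => @hopp C Y X)
    (fun X Y => @hadd C Y X)
    (fun X Y f => cmpm1 f) (fun X Y f => cmp1m f)
    (fun X Y Z W h g f => esym (cmpA f g h))
    (fun X Y => @haddA C Y X) (fun X Y => @haddC C Y X)
    (fun X Y => @hadd0 C Y X) (fun X Y => @haddN C Y X)
    (fun X Y Z g h f => cmpDr f g h) (fun X Y Z h f g => cmpDl f g h).

Definition fullsub (C : preadditive) (P : C -> Prop) : preadditive :=
  @Preadditive {X : C | P X} (fun X Y => hom (sval X) (sval Y))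
    (fun X => idm (sval X)) (fun X Y Z g f => g ∘ f)
    (fun X Y => hzero) (fun X Y => hopp) (fun X Y => hadd)
    (fun X Y => @cmp1m C _ _) (fun X Y => @cmpm1 C _ _)
    (fun X Y Z W => @cmpA C _ _ _ _)
    (fun X Y => @haddA C _ _) (fun X Y => @haddC C _ _)
    (fun X Y => @hadd0 C _ _) (fun X Y => @haddN C _ _)
    (fun X Y Z => @cmpDl C _ _ _) (fun X Y Z => @cmpDr C _ _ _).

Record functor (C D : preadditive) := Functor {
  fob :> C -> D;
  fmap : forall X Y : C, hom X Y -> hom (fob X) (fob Y);
  fmap1 : forall X : C, fmap (idm X) = idm (fob X);
  fmapM : forall (X Y Z : C) (g : hom Y Z) (f : hom X Y),
    fmap (g ∘ f) = fmap g ∘ fmap f;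
  fmapD : forall (X Y : C) (f g : hom X Y),
    fmap (hadd f g) = hadd (fmap f) (fmap g)
}.
Arguments fmap {C D} _ {X Y}.

Lemma fmap0 C D (F : functor C D) (X Y : C) :
  fmap F (hzero : hom X Y) = hzero.
Proof.
by apply: (@haddI _ _ _ (fmap F hzero)); rewrite -fmapD hadd0 [RHS]haddC hadd0.
Qed.

Lemma fmapN C D (F : functor C D) (X Y : C) (f : hom X Y) :
  fmap F (hopp f) = hopp (fmap F f).
Proof. by apply: (@haddI _ _ _ (fmap F f)); rewrite -fmapD !haddrN fmap0. Qed.

Section CompFunctor.
Variables (C D E : preadditive) (G : functor D E) (F : functor C D).

Definition compf : functor C E.
Proof.
refine (@Functor C E (fun X => G (F X)) (fun X Y f => fmap G (fmap F f)) _ _ _).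
- by move=> X; rewrite !fmap1.
- by move=> X Y Z g f; rewrite !fmapM.
- by move=> X Y f g; rewrite !fmapD.
Defined.
End CompFunctor.

Definition opfunctor C D (F : functor C D) : functor (opcat C) (opcat D) :=
  @Functor (opcat C) (opcat D) F (fun X Y f => fmap F f)
    (fun X => fmap1 F X) (fun X Y Z g f => fmapM F f g)
    (fun X Y f g => fmapD F f g).

Record nattrans C D (F G : functor C D) := NatTrans {
  ntr :> forall X : C, hom (F X) (G X);
  ntrP : forall (X Y : C) (f : hom X Y), fmap G f ∘ ntr X = ntr Y ∘ fmap F f
}.

Lemma nattrans_eq C D (F G : functor C D) (s t : nattrans F G) :
  (forall X, s X = t X) -> s = t.
Proof.
case: s t => [s sP] [t tP] /= st.
have {st} est : s = t by apply: functional_extensionality_dep.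
by rewrite est in sP *; rewrite (Prop_irrelevance sP tP).
Qed.

Section FunCat.
Variables C D : preadditive.
Implicit Types F G H : functor C D.

Definition nt_id F : nattrans F F.
Proof. by exists (fun X => idm (F X)) => X Y f; rewrite cmpm1 cmp1m. Defined.

Definition nt_cmp F G H (t : nattrans G H) (s : nattrans F G) : nattrans F H.
Proof.
by exists (fun X => t X ∘ s X) => X Y f; rewrite cmpA ntrP -!cmpA ntrP.
Defined.

Definition nt_zero F G : nattrans F G.
Proof. by exists (fun X => hzero) => X Y f; rewrite cmpm0 cmp0m. Defined.

Definition nt_opp F G (s : nattrans F G) : nattrans F G.
Proof.
by exists (fun X => hopp (s X)) => X Y f; rewrite cmpmN cmpNm ntrP.
Defined.

Definition nt_add F G (s t : nattrans F G) : nattrans F G.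
Proof.
by exists (fun X => hadd (s X) (t X)) => X Y f; rewrite cmpDr cmpDl !ntrP.
Defined.

Definition funcat : preadditive.
Proof.
refine (@Preadditive (functor C D) (@nattrans C D) nt_id nt_cmp
  nt_zero nt_opp nt_add _ _ _ _ _ _ _ _ _).
- by move=> F G s; apply: nattrans_eq => X; apply: cmp1m.
- by move=> F G s; apply: nattrans_eq => X; apply: cmpm1.
- by move=> F G H K u t s; apply: nattrans_eq => X; apply: cmpA.
- by move=> F G s t u; apply: nattrans_eq => X; apply: haddA.
- by move=> F G s t; apply: nattrans_eq => X; apply: haddC.
- by move=> F G s; apply: nattrans_eq => X; apply: hadd0.
- by move=> F G s; apply: nattrans_eq => X; apply: haddN.
- by move=> F G H s t u; apply: nattrans_eq => X; apply: cmpDl.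
- by move=> F G H s t u; apply: nattrans_eq => X; apply: cmpDr.
Defined.
End FunCat.

Definition left_adjoint (A B : preadditive) (L : functor A B)
    (R : functor B A) : Prop :=
  exists phi : forall (a : A) (b : B), hom (L a) b -> hom a (R b),
  [/\ forall a b, bijective (@phi a b),
      forall a b (u v : hom (L a) b),
        phi a b (hadd u v) = hadd (phi a b u) (phi a b v),
      forall (a a' : A) (b : B) (h : hom a' a) (u : hom (L a) b),
        phi a' b (u ∘ fmap L h) = phi a b u ∘ h
    & forall (a : A) (b b' : B) (k : hom b b') (u : hom (L a) b),
        phi a b' (k ∘ u) = fmap R k ∘ phi a b u].

(* L_0 T (X) is the 0-th homology of T applied to a projective resolution of X,
   that is the cokernel of T(P1) -> T(P0); a map X -> Y acts through a lift
   P0(X) -> P0(Y), whose choice is irrelevant. *)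
Section LeftDerived0.
Variables (A B : preadditive) (T : functor A B).
Variable P : forall X : A, proj_presentation X.
Variable K : forall (X Y : A) (f : hom X Y), cokernel (fmap T f).
Arguments K {X Y} f.

Definition L0_ob (X : A) : B := coker_ob (K (pres_d (P X))).
Definition L0_pr (X : A) : hom (T (pres0 (P X))) (L0_ob X) :=
  coker_pr (K (pres_d (P X))).

Definition is_lift (X Y : A) (h : hom X Y)
    (h0 : hom (pres0 (P X)) (pres0 (P Y))) : Prop :=
  pres_aug (P Y) ∘ h0 = h ∘ pres_aug (P X).

Lemma lift_exists (X Y : A) (h : hom X Y) : exists h0, is_lift h h0.
Proof. exact: (@pres0P _ _ (P X) _ _ _ (@pres_augP _ _ (P Y))). Qed.

Lemma L0_pr_kills (W Y : A) (w : hom W (pres0 (P Y))) :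
  projective W -> pres_aug (P Y) ∘ w = hzero -> L0_pr Y ∘ fmap T w = hzero.
Proof.
move=> Wproj w0.
have [Z [k [e [[_ kuniv] eepi de]]]] := pres_exact (P Y).
have [v [kv _]] := kuniv _ _ w0.
have [s es] := Wproj _ _ e eepi v.
have -> : w = pres_d (P Y) ∘ s by rewrite de -cmpA es.
rewrite fmapM cmpA /L0_pr.
by have [-> _] := coker_prP (K (pres_d (P Y))); rewrite cmp0m.
Qed.

Lemma lift_irrelevant (X Y : A) (h : hom X Y) h0 h0' :
  is_lift h h0 -> is_lift h h0' ->
  L0_pr Y ∘ fmap T h0 = L0_pr Y ∘ fmap T h0'.
Proof.
move=> l l'; apply: hadd_eq0; rewrite -cmpmN -fmapN -cmpDr -fmapD.
apply: L0_pr_kills; first exact: pres0P.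
by rewrite cmpDr cmpmN l l' haddrN.
Qed.

Lemma L0_map_exists (X Y : A) (h : hom X Y) :
  exists u : hom (L0_ob X) (L0_ob Y),
    forall h0, is_lift h h0 -> u ∘ L0_pr X = L0_pr Y ∘ fmap T h0.
Proof.
have [h0 hh0] := lift_exists h.
have [_ univ] := coker_prP (K (pres_d (P X))).
have [|u [uE _]] := univ _ (L0_pr Y ∘ fmap T h0).
  rewrite -cmpA -fmapM; apply: L0_pr_kills; first exact: pres1P.
  rewrite cmpA hh0 -cmpA.
  have [Z [k [e [[k0 _] _ ->]]]] := pres_exact (P X).
  by rewrite (cmpA (pres_aug _)) k0 cmp0m cmpm0.
by exists u => h0' hh0'; rewrite [LHS]uE; apply: lift_irrelevant hh0 hh0'.
Qed.

Definition L0_map (X Y : A) (h : hom X Y) : hom (L0_ob X) (L0_ob Y) :=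
  sval (cid (L0_map_exists h)).

Lemma L0_mapE (X Y : A) (h : hom X Y) h0 :
  is_lift h h0 -> L0_map h ∘ L0_pr X = L0_pr Y ∘ fmap T h0.
Proof. by rewrite /L0_map; case: cid => u /= uE; apply: uE. Qed.

Lemma L0_pr_epic (X : A) : epic (L0_pr X).
Proof. exact: is_cokernel_epic (coker_prP _). Qed.

Definition L0 : functor A B.
Proof.
refine (@Functor A B L0_ob L0_map _ _ _).
- move=> X; apply: L0_pr_epic.
  rewrite (@L0_mapE _ _ _ (idm _)) ?fmap1 ?cmpm1 ?cmp1m //.
  by rewrite /is_lift cmpm1 cmp1m.
- move=> X Y Z g f; apply: L0_pr_epic.
  have [[f0 lf] [g0 lg]] := (lift_exists f, lift_exists g).
  rewrite (@L0_mapE _ _ _ (g0 ∘ f0)).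
    by rewrite -cmpA (L0_mapE lf) cmpA (L0_mapE lg) fmapM cmpA.
  by rewrite /is_lift cmpA lg -cmpA lf cmpA.
- move=> X Y f g; apply: L0_pr_epic.
  have [[f0 lf] [g0 lg]] := (lift_exists f, lift_exists g).
  rewrite (@L0_mapE _ _ _ (hadd f0 g0)).
    by rewrite cmpDl (L0_mapE lf) (L0_mapE lg) fmapD cmpDr.
  by rewrite /is_lift cmpDr cmpDl lf lg.
Defined.
End LeftDerived0.

Section MkMorphisms.
Variables (A B : zmodType) (f : A -> B).
Hypothesis fD : {morph f : x y / x + y}.

Lemma mk_additive_subproof : zmod_morphism f.
Proof.
have f0 : f 0 = 0 by apply: (addrI (f 0)); rewrite -fD !addr0.
move=> x y; have <- : f (- y) = - f y; last by rewrite fD.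
by apply: (addrI (f y)); rewrite -fD !subrr.
Qed.

Definition mk_additive : {additive A -> B} :=
  HB.pack f (GRing.isZmodMorphism.Build A B f mk_additive_subproof).
End MkMorphisms.

Section MkLinear.
Variables (R : pzRingType) (A B : lmodType R) (f : A -> B).
Hypotheses (fD : {morph f : x y / x + y}) (fZ : forall a, {morph f : x / a *: x}).

Lemma mk_linear_subproof : linear f.
Proof. by move=> a x y; rewrite fD fZ. Qed.

Definition mk_linear : {linear A -> B} :=
  HB.pack f (GRing.isLinear.Build R A B _ f mk_linear_subproof).
End MkLinear.

Lemma additive_eq (A B : zmodType) (f g : {additive A -> B}) :
  f =1 g -> f = g.
Proof.
case: f g => [f [[f0]]] [g [[g0]]] /= /funext fg.
by rewrite fg in f0 *; rewrite (Prop_irrelevance f0 g0).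
Qed.

Lemma linear_eq (R : pzRingType) (A B : lmodType R) (f g : {linear A -> B}) :
  f =1 g -> f = g.
Proof.
case: f g => [f [[f0] [f1]]] [g [[g0] [g1]]] /= /funext fg.
rewrite fg in f0 f1 *.
by rewrite (Prop_irrelevance f0 g0) (Prop_irrelevance f1 g1).
Qed.

Definition Ab : preadditive.
Proof.
refine (@Preadditive zmodType (fun A B => {additive A -> B})
  (fun A => idfun) (fun A B C g f => g \o f) (fun A B => \0)
  (fun A B f => \- f) (fun A B f g => f \+ g) _ _ _ _ _ _ _ _ _).
- by move=> A B f; apply: additive_eq.
- by move=> A B f; apply: additive_eq.
- by move=> A B C D h g f; apply: additive_eq.
- by move=> A B f g h; apply: additive_eq => x; apply: addrA.
- by move=> A B f g; apply: additive_eq => x; apply: addrC.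
- by move=> A B f; apply: additive_eq => x; apply: add0r.
- by move=> A B f; apply: additive_eq => x; apply: addNr.
- by move=> A B C g h f; apply: additive_eq.
- by move=> A B C h f g; apply: additive_eq => x; apply: raddfD.
Defined.

Definition LMod (R : pzRingType) : preadditive.
Proof.
refine (@Preadditive (lmodType R) (fun A B => {linear A -> B})
  (fun A => idfun) (fun A B C g f => g \o f) (fun A B => \0)
  (fun A B f => \- f) (fun A B f g => f \+ g) _ _ _ _ _ _ _ _ _).
- by move=> A B f; apply: linear_eq.
- by move=> A B f; apply: linear_eq.
- by move=> A B C D h g f; apply: linear_eq.
- by move=> A B f g h; apply: linear_eq => x; apply: addrA.
- by move=> A B f g; apply: linear_eq => x; apply: addrC.
- by move=> A B f; apply: linear_eq => x; apply: add0r.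
- by move=> A B f; apply: linear_eq => x; apply: addNr.
- by move=> A B C g h f; apply: linear_eq.
- by move=> A B C h f g; apply: linear_eq => x; apply: raddfD.
Defined.

(* right R-modules are left modules over the converse ring *)
Definition finitely_presented (R : pzRingType) (M : LMod R) : Prop :=
  exists (m n : nat) (f : {linear 'rV[R]_m -> 'rV[R]_n})
         (p : {linear 'rV[R]_n -> M}),
    (forall x, exists v, p v = x) /\
    (forall v, p v = 0 <-> exists u, f u = v).

Definition modR (R : pzRingType) : preadditive :=
  @fullsub (LMod R^c) (@finitely_presented R^c).

Definition lhom (R : pzRingType) (X Y : lmodType R) : Type := {linear X -> Y}.

Section LHom.
Variables (R : pzRingType) (X Y : lmodType R).
HB.instance Definition _ := gen_eqMixin (lhom X Y).
HB.instance Definition _ := gen_choiceMixin (lhom X Y).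
HB.instance Definition _ := GRing.isZmodule.Build (lhom X Y)
  (@haddA (LMod R) X Y) (@haddC (LMod R) X Y)
  (@hadd0 (LMod R) X Y) (@haddN (LMod R) X Y).
End LHom.

Definition ahom (A B : zmodType) : Type := {additive A -> B}.

Section AHom.
Variables (A B : zmodType).
HB.instance Definition _ := gen_eqMixin (ahom A B).
HB.instance Definition _ := gen_choiceMixin (ahom A B).
HB.instance Definition _ := GRing.isZmodule.Build (ahom A B)
  (@haddA Ab A B) (@haddC Ab A B) (@hadd0 Ab A B) (@haddN Ab A B).
End AHom.

Section AbCokernel.
Variables (A B : zmodType) (f : {additive A -> B}).

Definition in_image : {pred B} := fun y => `[< exists x, f x = y >].

Lemma in_image_zmod_closed : zmod_closed in_image.
Proof.
split=> [|_ _ /asboolP[x <-] /asboolP[y <-]]; apply/asboolP.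
  by exists 0; rewrite raddf0.
by exists (x - y); rewrite raddfB.
Qed.
HB.instance Definition _ :=
  GRing.isZmodClosed.Build B in_image in_image_zmod_closed.

Definition acoker : zmodType := Quotient.quot in_image.
Definition acoker_pr : {additive B -> acoker} := \pi_acoker%qT.

Lemma acoker_pr_surj (y : acoker) : exists x, acoker_pr x = y.
Proof. by exists (repr y); rewrite /acoker_pr /= reprK. Qed.

Lemma acoker_pr_eq0 (y : B) : acoker_pr y = 0 <-> exists x, f x = y.
Proof.
rewrite -(raddf0 acoker_pr); split=> [/eqmodP|fy].
  by rewrite /= Quotient.equivE subr0 => /asboolP.
by apply/eqmodP; rewrite /= Quotient.equivE subr0; apply/asboolP.
Qed.
End AbCokernel.
Lemma acoker_prK (A B : zmodType) (f : {additive A -> B}) (z : acoker f) :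
  acoker_pr f (repr z) = z.
Proof. by rewrite /acoker_pr /= reprK. Qed.
Global Opaque acoker_pr.

Section AbCokernelLift.
Variables (A B C : zmodType) (f : {additive A -> B}) (g : {additive B -> C}).
Hypothesis gf0 : forall x, g (f x) = 0.

Lemma acoker_liftP (y : B) (z : acoker f) :
  acoker_pr f y = z -> g (repr z) = g y.
Proof.
move=> yz; apply/eqP; rewrite -subr_eq0 -raddfB; apply/eqP.
have /acoker_pr_eq0[x <-] : acoker_pr f (repr z - y) = 0.
  by rewrite raddfB yz acoker_prK subrr.
exact: gf0.
Qed.

Lemma acoker_lift_subproof : {morph (fun z : acoker f => g (repr z)) : x y / x + y}.
Proof.
move=> x y; rewrite -raddfD; apply: acoker_liftP.
by rewrite raddfD !acoker_prK.
Qed.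

Definition acoker_lift : {additive acoker f -> C} :=
  mk_additive acoker_lift_subproof.

Lemma acoker_liftE (y : B) : acoker_lift (acoker_pr f y) = g y.
Proof. exact: acoker_liftP. Qed.
End AbCokernelLift.
Global Opaque acoker_lift.

Lemma acoker_ind (A B : zmodType) (f : {additive A -> B}) (P : acoker f -> Prop) :
  (forall y, P (acoker_pr f y)) -> forall z, P z.
Proof. by move=> Pf z; have [y <-] := acoker_pr_surj z. Qed.

Section FunCokernel.
Variables (C : preadditive) (F G : functor C Ab) (s : nattrans F G).

Lemma ntr_natural (F1 F2 : functor C Ab) (t : nattrans F1 F2) (X Y : C)
  (f : hom X Y) x : fmap F2 f (t X x) = t Y (fmap F1 f x).
Proof. exact: (congr1 (fun h : {additive _ -> _} => h x) (ntrP t f)). Qed.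

Lemma fcoker_map_subproof (X Y : C) (f : hom X Y) (x : F X) :
  (acoker_pr (s Y) \o fmap G f) (s X x) = 0.
Proof. by rewrite /= ntr_natural; apply/acoker_pr_eq0; exists (fmap F f x). Qed.

Definition fcoker : functor C Ab.
Proof.
refine (@Functor C Ab (fun X => acoker (s X))
  (fun X Y f => acoker_lift (fcoker_map_subproof f)) _ _ _).
- move=> X; apply: additive_eq; elim/acoker_ind => y.
  by rewrite acoker_liftE /= fmap1.
- move=> X Y Z g f; apply: additive_eq; elim/acoker_ind => y.
  by rewrite /= !(acoker_liftE (fcoker_map_subproof _)) /= fmapM.
- move=> X Y f g; apply: additive_eq; elim/acoker_ind => y.
  by rewrite /= !acoker_liftE /= fmapD -raddfD.
Defined.

Definition fcoker_pr : nattrans G fcoker.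
Proof.
exists (fun X => acoker_pr (s X)) => X Y f.
by apply: additive_eq => x; rewrite /= acoker_liftE.
Defined.

Lemma fcoker_prP : @is_cokernel (funcat C Ab) F G fcoker s fcoker_pr.
Proof.
split=> [|H t ts0].
  by apply: nattrans_eq => X; apply: additive_eq => x; apply/acoker_pr_eq0; exists x.
have ts0' X x : t X (s X x) = 0.
  by have := congr1 (fun u : nattrans F H => (u X : {additive _ -> _}) x) ts0.
have nat_u (X Y : C) (f : hom X Y) :
    fmap H f ∘ (acoker_lift (ts0' X) : @hom Ab (fcoker X) (H X)) =
    (acoker_lift (ts0' Y) : @hom Ab (fcoker Y) (H Y)) ∘ fmap fcoker f.
  apply: additive_eq; elim/acoker_ind => y.
  by rewrite /= (acoker_liftE (ts0' _)) (acoker_liftE (fcoker_map_subproof _)) /=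
    (acoker_liftE (ts0' _)) ntr_natural.
exists (NatTrans nat_u); split=> [|v vt].
  by apply: nattrans_eq => X; apply: additive_eq => x; rewrite /= (acoker_liftE (ts0' _)).
apply: nattrans_eq => X; apply: additive_eq; elim/acoker_ind => y.
by rewrite /= (acoker_liftE (ts0' _)) -vt.
Qed.
End FunCokernel.

Section Functors.
Variable R : pzRingType.

Definition lhom_post (X Y Z : LMod R) (g : hom Y Z) :
    {additive lhom X Y -> lhom X Z} :=
  @mk_additive (lhom X Y) (lhom X Z)
    (fun f => @cmp (LMod R) X Y Z g f) (@cmpDr (LMod R) X Y Z g).

Definition lhom_pre (X Y Z : LMod R) (f : hom X Y) :
    {additive lhom Y Z -> lhom X Z} :=
  @mk_additive (lhom Y Z) (lhom X Z) (fun g => @cmp (LMod R) X Y Z g f)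
    (fun g g' => @cmpDl (LMod R) X Y Z g g' f).

Definition rep (X : LMod R) : functor (LMod R) Ab.
Proof.
refine (@Functor (LMod R) Ab (fun Y => lhom X Y : zmodType)
  (fun Y Z g => lhom_post X g) _ _ _).
- by move=> Y; apply: additive_eq => f; apply: (@cmp1m (LMod R)).
- move=> Y Z W g f; apply: additive_eq => h.
  by symmetry; apply: (@cmpA (LMod R)).
- by move=> Y Z f g; apply: additive_eq => h; apply: (@cmpDl (LMod R)).
Defined.

Definition rep_map (X Y : LMod R) (f : hom X Y) : nattrans (rep Y) (rep X).
Proof.
exists (fun Z => lhom_pre Z f).
by move=> Z W g; apply: additive_eq => h; apply: (@cmpA (LMod R)).
Defined.

(* the sequence (Y,-) -> (X,-) -> F -> 0 is exact; exactness is pointwise *)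
Definition fp_functor (F : funcat (LMod R) Ab) : Prop :=
  exists (X Y : LMod R) (a : nattrans (rep Y) (rep X)) (p : nattrans (rep X) F),
  forall Z : LMod R,
    (forall y : F Z, exists x, p Z x = y) /\
    (forall x : rep X Z, p Z x = 0 <-> exists w, a Z w = x).

Definition fp : preadditive := fullsub fp_functor.

Lemma rep_fp (X : LMod R) : fp_functor (rep X).
Proof.
exists X, X, (nt_zero _ _), (nt_id _) => Z; split=> [y|x]; first by exists y.
by split=> [x0|[w <-]] //; exists 0; symmetry; exact: x0.
Qed.

Definition yoneda : functor (opcat (LMod R)) fp.
Proof.
refine (@Functor (opcat (LMod R)) fp (fun X => exist _ (rep X) (rep_fp X))
  (fun X Y f => rep_map f) _ _ _).
- move=> X; apply: nattrans_eq => Z; apply: additive_eq => g.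
  exact: (@cmpm1 (LMod R)).
- move=> X Y Z g f; apply: nattrans_eq => W; apply: additive_eq => h.
  exact: (@cmpA (LMod R)).
- move=> X Y f g; apply: nattrans_eq => W; apply: additive_eq => h.
  exact: (@cmpDr (LMod R)).
Defined.

Lemma fcoker_rep_fp (X Y : LMod R) (a : nattrans (rep Y) (rep X)) :
  fp_functor (fcoker a).
Proof.
exists X, Y, a, (fcoker_pr a) => Z; split=> [y|x].
  exact: acoker_pr_surj.
exact: acoker_pr_eq0.
Qed.

Definition rep_coker (X Y : LMod R)
    (a : @hom fp (exist _ (rep Y) (rep_fp Y)) (exist _ (rep X) (rep_fp X))) :
  cokernel a.
Proof.
exists (exist _ (fcoker (a : nattrans _ _)) (fcoker_rep_fp (a : nattrans _ _)))
  (fcoker_pr (a : nattrans (rep Y) (rep X))).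
have [h1 h2] := fcoker_prP (a : nattrans (rep Y) (rep X)).
by split=> [//|[H fpH]]; apply: h2.
Defined.
End Functors.

Section Tensor.
Variables (R : pzRingType) (M : LMod R^c) (X : LMod R).

Definition free_tensor : zmodType := {freeg (M * X)%type / int}.

Definition free_pure (m : M) (x : X) : free_tensor := Freeg [:: (1%:Z, (m, x))].

Inductive tensor_relator : free_tensor -> Prop :=
| RelDl m m' x : tensor_relator
    (free_pure (m + m') x - (free_pure m x + free_pure m' x))
| RelDr m x x' : tensor_relator
    (free_pure m (x + x') - (free_pure m x + free_pure m x'))
  (* (m r) ⊗ x = m ⊗ (r x); the scalar action of R^c on M is written m r *)
| RelZ (r : R) m x : tensor_relator
    (free_pure ((r : R^c) *: m) x - free_pure m (r *: x)).

Definition tensor_relations : {pred free_tensor} := fun t =>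
  `[< forall S : {pred free_tensor}, zmod_closed S ->
      (forall u, tensor_relator u -> u \in S) -> t \in S >].

Lemma tensor_relations_zmod_closed : zmod_closed tensor_relations.
Proof.
split=> [|u v /asboolP uP /asboolP vP]; apply/asboolP => S clS relS.
  by case: clS.
by case: (clS) => _; apply; [apply: uP|apply: vP].
Qed.
HB.instance Definition _ := GRing.isZmodClosed.Build free_tensor
  tensor_relations tensor_relations_zmod_closed.

Definition tensor : zmodType := Quotient.quot tensor_relations.

Definition tensor_pr : {additive free_tensor -> tensor} := \pi_tensor%qT.

Definition pure (m : M) (x : X) : tensor := tensor_pr (free_pure m x).

Lemma tensor_prK (t : tensor) : tensor_pr (repr t) = t.
Proof. by rewrite /tensor_pr /= reprK. Qed.

Lemma tensor_pr_eq0 (u : free_tensor) : tensor_pr u = 0 <-> u \in tensor_relations.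
Proof.
rewrite -(raddf0 tensor_pr); split=> [/eqmodP|ru].
  by rewrite /= Quotient.equivE subr0.
by apply/eqmodP; rewrite /= Quotient.equivE subr0.
Qed.

Lemma tensor_relatorP (u : free_tensor) : tensor_relator u -> tensor_pr u = 0.
Proof. by move=> ru; apply/tensor_pr_eq0; apply/asboolP => S _; apply. Qed.

Lemma pureDl m m' x : pure (m + m') x = pure m x + pure m' x.
Proof.
apply/eqP; rewrite -subr_eq0 -!raddfD -raddfB; apply/eqP.
exact: tensor_relatorP (RelDl _ _ _).
Qed.

Lemma pureDr m x x' : pure m (x + x') = pure m x + pure m x'.
Proof.
apply/eqP; rewrite -subr_eq0 -!raddfD -raddfB; apply/eqP.
exact: tensor_relatorP (RelDr _ _ _).
Qed.

Lemma pureZ (r : R) m x : pure ((r : R^c) *: m) x = pure m (r *: x).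
Proof.
apply/eqP; rewrite -subr_eq0 -raddfB; apply/eqP.
exact: tensor_relatorP (RelZ _ _ _).
Qed.

Section FreeLift.
Variables (A : zmodType) (b : M -> X -> A).

Definition free_lift (u : free_tensor) : A :=
  fglift (fun mx : M * X => b mx.1 mx.2 : zmodule A) u.

Lemma free_lift_zmod_morphism : zmod_morphism free_lift.
Proof.
exact: (@lift_is_additive int _ (zmodule A) (fun mx : M * X => b mx.1 mx.2)).
Qed.
HB.instance Definition _ :=
  GRing.isZmodMorphism.Build free_tensor A free_lift free_lift_zmod_morphism.

Lemma free_liftE m x : free_lift (free_pure m x) = b m x.
Proof. by rewrite /free_lift /free_pure liftU scale1r. Qed.
End FreeLift.

Lemma free_ext (A : zmodType) (f g : {additive free_tensor -> A}) :
  (forall m x, f (free_pure m x) = g (free_pure m x)) -> f =1 g.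
Proof.
move=> fg u; rewrite -(freeg_sumE u) !raddf_sum; apply: eq_bigr => -[m x] _.
rewrite -[coeff _ _]intz -freegU_mulz -[LHS]/(f _) -[RHS]/(g _).
by rewrite !raddfMz -[Freeg _]/(free_pure m x) fg.
Qed.

Lemma tensor_ext (A : zmodType) (f g : {additive tensor -> A}) :
  (forall m x, f (pure m x) = g (pure m x)) -> f = g.
Proof.
move=> fg; apply: additive_eq => t; rewrite -(tensor_prK t).
exact: (@free_ext A (f \o tensor_pr) (g \o tensor_pr) fg).
Qed.

Section TensorLift.
Variables (A : zmodType) (b : M -> X -> A).
Hypotheses (bDl : forall m m' x, b (m + m') x = b m x + b m' x)
  (bDr : forall m x x', b m (x + x') = b m x + b m x')
  (bZ : forall (r : R) m x, b ((r : R^c) *: m) x = b m (r *: x)).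

Lemma free_lift_relations u : tensor_pr u = 0 -> free_lift b u = 0.
Proof.
move=> /tensor_pr_eq0 /asboolP.
move=> /(_ [pred u | free_lift b u == 0]) H; apply/eqP; apply: H.
  split=> [|v w]; rewrite !inE ?raddf0 // => /eqP v0 /eqP w0.
  by rewrite raddfB -[0]subr0; apply/eqP; congr (_ - _).
move=> _ [m m' x|m x x'|r m x]; rewrite inE raddfB subr_eq0 ?raddfD /=
  !free_liftE; apply/eqP; [exact: bDl | exact: bDr | exact: bZ].
Qed.

Lemma tensor_lift_pr u : free_lift b (repr (tensor_pr u)) = free_lift b u.
Proof.
apply/eqP; rewrite -subr_eq0 -raddfB; apply/eqP/free_lift_relations.
by rewrite raddfB tensor_prK subrr.
Qed.

Lemma tensor_lift_subproof :
  {morph (fun t : tensor => free_lift b (repr t)) : s t / s + t}.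
Proof.
move=> s t; rewrite -raddfD -[RHS]tensor_lift_pr.
by rewrite raddfD !tensor_prK.
Qed.

Definition tensor_lift : {additive tensor -> A} :=
  mk_additive tensor_lift_subproof.

Lemma tensor_liftE m x : tensor_lift (pure m x) = b m x.
Proof. by rewrite /= tensor_lift_pr free_liftE. Qed.
End TensorLift.
End Tensor.
Global Opaque tensor_pr tensor_lift.

Section TensorFunctor.
Variable R : pzRingType.

Section TensorMap.
Variables (M M' : LMod R^c) (X X' : LMod R) (f : {linear M -> M'})
  (g : {linear X -> X'}).

Definition tensor_map : {additive tensor M X -> tensor M' X'}.
Proof.
apply: (@tensor_lift R M X (tensor M' X') (fun m x => pure (f m) (g x))).
- by move=> m m' x; rewrite raddfD pureDl.
- by move=> m x x'; rewrite raddfD pureDr.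
- by move=> r m x; rewrite !linearZ pureZ.
Defined.

Lemma tensor_mapE m x : tensor_map (pure m x) = pure (f m) (g x).
Proof. exact: tensor_liftE. Qed.
End TensorMap.
Opaque tensor_map.

Definition tensorf (M : LMod R^c) : functor (LMod R) Ab.
Proof.
refine (@Functor (LMod R) Ab (fun X => tensor M X)
  (fun X Y g => tensor_map idfun g) _ _ _).
- by move=> X; apply: tensor_ext => m x; rewrite tensor_mapE.
- by move=> X Y Z g f; apply: tensor_ext => m x; rewrite /= !tensor_mapE.
- move=> X Y f g; apply: tensor_ext => m x.
  by rewrite /= !tensor_mapE pureDr.
Defined.

Definition tensorf_map (M M' : LMod R^c) (f : hom M M') :
  nattrans (tensorf M) (tensorf M').
Proof.
exists (fun X => tensor_map f idfun) => X Y g.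
by apply: tensor_ext => m x; rewrite /= !tensor_mapE.
Defined.
End TensorFunctor.
Global Opaque tensor_map.

Section SmallNat.
Variable R : pzRingType.
Variables (F : fp R) (H : functor (LMod R) Ab).

Let F0 : functor (LMod R) Ab := sval F.

Lemma fp_generated : exists g : {X : LMod R & F0 X},
  forall (Y : LMod R) (y : F0 Y),
    exists f : hom (projT1 g) Y, fmap F0 f (projT2 g) = y.
Proof.
rewrite /F0; case: F => F1 [X [Y [a [p pP]]]] /=.
pose F2 : functor (LMod R) Ab := F1.
exists (existT (fun X => F2 X) X (p X (idm X : lhom X X))) => Z z /=.
have [/(_ z)[f pf] _] := pP Z.
by exists f; rewrite (ntr_natural p) -pf; congr (p Z _); apply: linear_eq.
Qed.

Definition gen_ob : LMod R := projT1 (sval (cid fp_generated)).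
Definition gen_elt : F0 gen_ob := projT2 (sval (cid fp_generated)).

Lemma gen_eltP (Y : LMod R) (y : F0 Y) :
  exists f : hom gen_ob Y, fmap F0 f gen_elt = y.
Proof. by rewrite /gen_elt /gen_ob; case: cid => g gP; apply: gP. Qed.

Lemma gen_elt_inj (s t : nattrans F0 H) :
  s gen_ob gen_elt = t gen_ob gen_elt -> s = t.
Proof.
move=> st; apply: nattrans_eq => Y; apply: additive_eq => y.
by have [f <-] := gen_eltP y; rewrite -!ntr_natural st.
Qed.

Definition nat_value : {pred H gen_ob} :=
  fun y => `[< exists s : nattrans F0 H, s gen_ob gen_elt = y >].

Lemma nat_value_zmod_closed : zmod_closed nat_value.
Proof.
split=> [|_ _ /asboolP[s <-] /asboolP[t <-]]; apply/asboolP.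
  by exists (nt_zero _ _).
by exists (nt_add s (nt_opp t)).
Qed.
HB.instance Definition _ :=
  GRing.isZmodClosed.Build (H gen_ob) nat_value nat_value_zmod_closed.

(* The natural transformations F -> H form a large type; they are represented
   by their values at an element generating F, which determine them
   ([small_natK], [nat_smallK], [small_natD]). *)
Record small_nat := SmallNat {
  small_nat_val :> H gen_ob;
  small_natP : small_nat_val \in nat_value
}.
HB.instance Definition _ := [isSub for small_nat_val].
HB.instance Definition _ := [Choice of small_nat by <:].
HB.instance Definition _ := [SubChoice_isSubZmodule of small_nat by <:].

Lemma to_small_subproof (s : nattrans F0 H) : s gen_ob gen_elt \in nat_value.
Proof. by apply/asboolP; exists s. Qed.

Definition to_small (s : nattrans F0 H) : small_nat :=
  SmallNat (to_small_subproof s).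

Definition of_small (x : small_nat) : nattrans F0 H :=
  sval (cid (asboolW (small_natP x))).

Lemma of_smallK : cancel of_small to_small.
Proof. by move=> x; apply: val_inj; rewrite /= /of_small; case: cid. Qed.

Lemma to_smallK : cancel to_small of_small.
Proof. by move=> s; apply: gen_elt_inj; rewrite /of_small; case: cid. Qed.

Lemma to_smallD s t : to_small (nt_add s t) = to_small s + to_small t.
Proof. exact: val_inj. Qed.

Lemma of_smallD x y : of_small (x + y) = nt_add (of_small x) (of_small y).
Proof. by apply: (can_inj to_smallK); rewrite to_smallD !of_smallK. Qed.
End SmallNat.
Global Opaque to_small of_small.

Section DA.
Variable R : pzRingType.

(* (D_A F) M = (F, M ⊗ -), through [small_nat] *)
Definition DA_ob_map (F : fp R) (M N : modR R) (f : hom M N) :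
  {additive small_nat F (tensorf (sval M)) -> small_nat F (tensorf (sval N))}.
Proof.
apply: (@mk_additive _ _ (fun x => to_small (nt_cmp (tensorf_map f) (of_small x)))).
move=> x y; rewrite of_smallD -to_smallD; congr to_small.
exact: (@cmpDr (funcat (LMod R) Ab)).
Defined.

Definition DA_ob (F : fp R) : functor (modR R) Ab.
Proof.
refine (@Functor (modR R) Ab (fun M => small_nat F (tensorf (sval M)) : zmodType)
  (fun M N f => DA_ob_map F f) _ _ _).
- move=> M; apply: additive_eq => x; rewrite -[RHS]of_smallK; congr to_small.
  apply: nattrans_eq => X; apply: additive_eq => y /=.
  rewrite (_ : tensor_map _ _ = idfun) //.
  by apply: tensor_ext => m z; rewrite tensor_mapE.
- move=> M N P g f; apply: additive_eq => x; rewrite /= to_smallK; congr to_small.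
  apply: nattrans_eq => X; apply: additive_eq => y /=.
  rewrite (_ : tensor_map (g ∘ f) _ = tensor_map g idfun \o tensor_map f idfun) //.
  by apply: tensor_ext => m z; rewrite /= !tensor_mapE.
- move=> M N f g; apply: additive_eq => x; rewrite /= -to_smallD; congr to_small.
  apply: nattrans_eq => X; apply: additive_eq => y /=.
  rewrite (_ : tensor_map (hadd f g) _ = tensor_map f idfun \+ tensor_map g idfun) //.
  by apply: tensor_ext => m z; rewrite /= !tensor_mapE pureDl.
Defined.

Definition DA_map (F F' : fp R) (h : hom F F') : nattrans (DA_ob F') (DA_ob F).
Proof.
unshelve refine (@NatTrans _ _ (DA_ob F') (DA_ob F) (fun M => @mk_additive
    (small_nat F' (tensorf (sval M))) (small_nat F (tensorf (sval M)))
    (fun x => to_small (nt_cmp (of_small x) h)) _) _).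
- move=> x y; rewrite of_smallD -to_smallD; congr to_small.
  exact: (@cmpDl (funcat (LMod R) Ab)).
- move=> M N f; apply: additive_eq => x; rewrite /= !to_smallK; congr to_small.
  exact: (@cmpA (funcat (LMod R) Ab)).
Defined.

Definition DA : functor (fp R) (opcat (funcat (modR R) Ab)).
Proof.
refine (@Functor (fp R) (opcat (funcat (modR R) Ab)) DA_ob DA_map _ _ _).
- move=> F; apply: nattrans_eq => M; apply: additive_eq => x.
  rewrite -[RHS]of_smallK; congr to_small.
  exact: (@cmpm1 (funcat (LMod R) Ab)).
- move=> F G H g f; apply: nattrans_eq => M; apply: additive_eq => x.
  rewrite /= to_smallK; congr to_small.
  exact: (@cmpA (funcat (LMod R) Ab)).
- move=> F G f g; apply: nattrans_eq => M; apply: additive_eq => x.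
  rewrite /= -to_smallD; congr to_small.
  exact: (@cmpDr (funcat (LMod R) Ab)).
Defined.
End DA.

Section Evaluation.
Variable R : pzRingType.

Lemma regular_fp : @finitely_presented R^c R^c^o.
Proof.
pose p : 'rV[R^c]_1 -> R^c^o := fun v => v 0 0.
have pD : {morph p : u v / u + v} by move=> u v; rewrite /p mxE.
have pZ a : {morph p : v / a *: v} by move=> v; rewrite /p mxE.
exists 0%N, 1%N, (\0 : {linear 'rV_0 -> 'rV_1}), (mk_linear pD pZ).
split=> [x|v]; first by exists (const_mx x); rewrite /= /p mxE.
split=> [v0|[u <-]]; last exact: (raddf0 (mk_linear pD pZ)).
by exists 0; apply/rowP => i; rewrite ord1 mxE; symmetry; exact: v0.
Qed.

Definition RR : modR R := exist _ (R^c^o : LMod R^c) regular_fp.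

(* x |-> r x, as an endomorphism of R_R; in R^c the product r x reads x * r *)
Definition lmul (r : R) : @hom (modR R) RR RR.
Proof.
apply: (@mk_linear R^c R^c^o R^c^o (fun x => (x : R^c) * (r : R^c))).
- by move=> x y; rewrite mulrDl.
- by move=> a x; rewrite /= -[_ *: x]/((a : R^c) * x) -mulrA.
Defined.

Lemma lmulE (r : R) (x : R) : (lmul r : {linear _ -> _}) x = r * x :> R.
Proof. by []. Qed.

Section EvModule.
Variable G : functor (modR R) Ab.

Definition ev_ob : Type := G RR.
HB.instance Definition _ := GRing.Zmodule.on ev_ob.

Definition ev_scale (r : R) (x : ev_ob) : ev_ob := fmap G (lmul r) x.

Lemma ev_scaleA a b v : ev_scale a (ev_scale b v) = ev_scale (a * b) v.
Proof.
transitivity ((fmap G (lmul a) ∘ fmap G (lmul b)) v) => //.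
rewrite -fmapM; congr (fmap G _ v); apply: linear_eq => x /=.
by rewrite -mulrA.
Qed.

Lemma ev_scale1 v : ev_scale 1 v = v.
Proof.
transitivity (idm (G RR) v) => //; rewrite -fmap1.
by congr (fmap G _ v); apply: linear_eq => x /=; rewrite mulr1.
Qed.

Lemma ev_scaleDr : right_distributive ev_scale +%R.
Proof. by move=> r v w; rewrite /ev_scale raddfD. Qed.

Lemma ev_scaleDl v : {morph ev_scale^~ v : a b / a + b}.
Proof.
move=> a b; transitivity (hadd (fmap G (lmul a)) (fmap G (lmul b)) v) => //.
rewrite -fmapD; congr (fmap G _ v); apply: linear_eq => x /=.
by rewrite mulrDr.
Qed.

HB.instance Definition _ := GRing.Zmodule_isLmodule.Build R ev_ob
  ev_scaleA ev_scale1 ev_scaleDr ev_scaleDl.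
End EvModule.

Definition ev_map (G G' : functor (modR R) Ab) (s : nattrans G G') :
  {linear ev_ob G -> ev_ob G'}.
Proof.
apply: (@mk_linear R (ev_ob G) (ev_ob G') (s RR)).
- by move=> x y; apply: raddfD.
- by move=> r x; symmetry; apply: ntr_natural.
Defined.

Definition ev : functor (funcat (modR R) Ab) (LMod R).
Proof.
refine (@Functor (funcat (modR R) Ab) (LMod R) (fun G => ev_ob G : lmodType R)
  ev_map _ _ _).
- by move=> G; apply: linear_eq.
- by move=> F G H t s; apply: linear_eq.
- by move=> F G s t; apply: linear_eq.
Defined.
End Evaluation.

Section Divisible.
Local Open Scope classical_set_scope.
Variables (A D : zmodType).
Hypothesis Ddiv : forall (d : D) (n : nat), (0 < n)%N -> exists y, y *+ n = d.

(* graphs of additive maps from a subgroup of A to D *)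
Definition partial_hom (S : set (A * D)) : Prop :=
  [/\ S 0, forall u v, S u -> S v -> S (u - v) & forall d, S (0, d) -> d = 0].

Lemma partial_homMz S u (k : int) : partial_hom S -> S u -> S (u *~ k).
Proof.
move=> [S0 SB _] Su.
have SN v : S v -> S (- v) by move=> Sv; rewrite -sub0r; apply: SB.
have SMn n : S (u *+ n).
  elim: n => [|n IH]; first by rewrite mulr0n.
  by rewrite mulrSr -[u in _ + u]opprK; apply: SB => //; apply: SN.
by case: k => n; [rewrite -pmulrn | rewrite NegzE -nmulrn; apply: SN].
Qed.

Lemma partial_hom_fun S a d d' :
  partial_hom S -> S (a, d) -> S (a, d') -> d = d'.
Proof.
move=> [_ SB S1] ad ad'; apply/eqP; rewrite -subr_eq0; apply/eqP/S1.
by have := SB _ _ ad ad'; rewrite /GRing.opp /GRing.add /= /add_pair /= subrr.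
Qed.

Lemma mulz_pair (a : A) (d : D) (k : int) : (a, d) *~ k = (a *~ k, d *~ k).
Proof.
have H n : (a, d) *+ n = (a *+ n, d *+ n) by elim: n => // n IH; rewrite !mulrS IH.
by case: k => n; rewrite -?pmulrn ?NegzE -?nmulrn H.
Qed.

Lemma partial_hom_slope S x : partial_hom S ->
  exists y : D, forall (k : int) c, S (x *~ k, c) -> c = y *~ k.
Proof.
move=> hS; pose Q n := `[< (0 < n)%N /\ exists c, S (x *+ n, c) >].
have [exQ|noQ] := pselect (exists n, Q n); last first.
  exists 0 => k c Skc; rewrite mul0rz.
  suff k0 : k = 0.
    by rewrite k0 mulr0z in Skc; case: hS => _ _; apply.
  apply/eqP/negPn/negP => kn0; apply: noQ; exists `|k|%N; apply/asboolP; split.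
    by rewrite absz_gt0.
  have [k0|k0] := lerP 0 k.
    by exists c; rewrite pmulrn gez0_abs.
  exists (- c); rewrite pmulrn ltz0_abs // -[X in S X]/((x *~ - k, - c)).
  have := partial_homMz (-1) hS Skc.
  by rewrite mulz_pair -mulrzA mulrN1 mulrN1z.
pose d := ex_minn exQ.
have [/asboolP[d0 [c0 Sd]] dmin] : Q d /\ forall n, Q n -> (d <= n)%N.
  by rewrite /d; case: ex_minnP.
have [y yd] := Ddiv c0 d0.
exists y => k c Skc.
have dn0 : (d%:Z != 0) by rewrite eqz_nat -lt0n.
have Sq : S (x *~ (k %% d%:Z)%Z, c - c0 *~ (k %/ d%:Z)%Z).
  case: (hS) => _ SB _.
  have := SB _ _ Skc (partial_homMz (k %/ d%:Z)%Z hS Sd).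
  rewrite mulz_pair pmulrn -mulrzA.
  have -> : (k %% d%:Z)%Z = k - d%:Z * (k %/ d%:Z)%Z by rewrite /modz mulrC.
  by rewrite mulrzBr.
have r0 : (k %% d%:Z)%Z = 0.
  have rge : 0 <= (k %% d%:Z)%Z by apply: modz_ge0.
  have rlt : (k %% d%:Z)%Z < d%:Z by rewrite ltz_pmod // ltz_nat.
  case E : (k %% d%:Z)%Z rge rlt => [n|//] _; rewrite ltz_nat => nd.
  have [n0|n0] := posnP n; first by rewrite n0.
  suff /dmin : Q n by rewrite leqNgt nd.
  apply/asboolP; split=> //; exists (c - c0 *~ (k %/ d%:Z)%Z).
  by move: Sq; rewrite E pmulrn.
rewrite r0 mulr0z in Sq.
case: (hS) => _ _ /(_ _ Sq) /eqP; rewrite subr_eq0 => /eqP ->.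
by rewrite -yd pmulrn -mulrzA [in RHS](divz_eq k d%:Z) r0 addr0 mulrC.
Qed.

Lemma partial_hom_extend S x : partial_hom S ->
  exists S', [/\ partial_hom S', S `<=` S' & exists y, S' (x, y)].
Proof.
move=> hS; have [y yP] := partial_hom_slope x hS.
pose S' : set (A * D) := fun u => exists (v : A * D) (k : int), S v /\ u = v + (x, y) *~ k.
case: (hS) => S0 SB S1.
have SS' : S `<=` S' by move=> u Su; exists u, 0; rewrite mulr0z addr0.
exists S'; split=> //; last first.
  by exists y; exists 0, 1; split=> //; rewrite add0r mulr1z.
split; first exact: SS'.
- move=> _ _ [u [k [Su ->]]] [v [l [Sv ->]]].
  exists (u - v), (k - l); split; first exact: SB.
  by rewrite mulrzBr opprD addrACA.
- move=> d [[a b] [k [Sab]]]; rewrite mulz_pair => -[] /esym /eqP.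
  rewrite addr_eq0 => /eqP ea ->.
  have := yP (- k) b; rewrite mulrNz -ea => /(_ Sab) ->.
  by rewrite mulrNz addNr.
Qed.

Lemma divisible_extend S0 : partial_hom S0 ->
  exists g : {additive A -> D}, forall a d, S0 (a, d) -> g a = d.
Proof.
move=> hS0.
have [S [hS Smax]] : exists S, partial_hom (S `|` S0) /\
    forall S', S `<` S' -> ~ partial_hom (S' `|` S0).
  apply: (@Zorn_bigcup _ (fun S => partial_hom (S `|` S0))) => F FP Ftot.
  set U := _ `|` _.
  have UP u v : U u -> U v -> exists T, [/\ partial_hom T, T `<=` U, T u & T v].
    have XU X : F X -> X `|` S0 `<=` U by move=> FX w [Xw|]; [left; exists X|right].
    move=> [[X FX Xu]|S0u] [[Y FY Yv]|S0v].
    - have [XY|YX] := Ftot _ _ FX FY.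
        by exists (Y `|` S0); split; [exact: FP|exact: XU|left; exact: XY|left].
      by exists (X `|` S0); split; [exact: FP|exact: XU|left|left; exact: YX].
    - by exists (X `|` S0); split; [exact: FP|exact: XU|left|right].
    - by exists (Y `|` S0); split; [exact: FP|exact: XU|right|left].
    - by exists S0; split=> // w; right.
  have U0 : U 0 by right; case: hS0.
  split=> //.
  - by move=> u v Uu Uv; have [T [[_ TB _] TU Tu Tv]] := UP _ _ Uu Uv; apply/TU/TB.
  - by move=> d Ud; have [T [[_ _ T1] _ Tu _]] := UP _ _ Ud U0; apply: T1.
set T := S `|` S0 in hS.
have tot a : exists d, T (a, d).
  have [//|nT] := pselect (exists d, T (a, d)); exfalso.
  have [S' [hS' TS' [y S'y]]] := partial_hom_extend a hS.
  apply: (Smax S'); last first.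
    by rewrite setUidl // => u S0u; apply: TS'; right.
  split; first by move=> u Su; apply: TS'; left.
  by move=> /(_ (a, y) S'y) Say; apply: nT; exists y; left.
pose g a := sval (cid (tot a)).
have gP a : T (a, g a) by rewrite /g; case: cid.
have gD : {morph g : a b / a + b}.
  move=> a b; apply: (@partial_hom_fun T (a + b)) => //.
  case: (hS) => T0 TB _.
  have -> : (a + b, g a + g b) = 0 - ((0 - (a, g a)) - (b, g b)).
    by rewrite !sub0r opprD !opprK.
  exact: TB T0 (TB _ _ (TB _ _ T0 (gP a)) (gP b)).
exists (mk_additive gD) => a d S0ad; apply: (partial_hom_fun hS) (gP a) _.
by right.
Qed.
End Divisible.

Definition QZ : zmodType := @acoker int rat intr.

Lemma QZ_divisible (d : QZ) (n : nat) : (0 < n)%N -> exists y, y *+ n = d.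
Proof.
move=> n0; elim/acoker_ind: d => q.
have qE : ((q : rat) / n%:R) *+ n = (q : rat).
  by rewrite -[LHS]mulr_natr divfK // pnatr_eq0 -lt0n.
by exists (acoker_pr _ ((q : rat) / n%:R)); rewrite -raddfMn /= qE.
Qed.

Lemma QZ_order (n : nat) : (1 < n)%N ->
  exists q : QZ, q != 0 /\ q *+ n = 0.
Proof.
move=> n1; have nn0 : n%:R != 0 :> rat by rewrite pnatr_eq0 -lt0n ltnW.
exists (acoker_pr _ (n%:R^-1 : rat)); split; last first.
  have nE : (n%:R^-1 : rat) *+ n = 1 by rewrite -[LHS]mulr_natr mulVf.
  rewrite -raddfMn /= nE.
  by apply/acoker_pr_eq0; exists 1.
apply/eqP => /acoker_pr_eq0[z /= zn].
have : z%:~R * n%:R = 1 :> rat.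
  have zq : z%:~R = n%:R^-1 :> rat by exact: zn.
  by rewrite zq mulVf.
rewrite pmulrn -intrM -[1]/(1%:~R) => /intr_inj zn1.
have : (n %| 1)%N by rewrite -(@dvdzE n%:Z 1); apply/dvdzP; exists z.
by rewrite dvdn1 => /eqP n1'; rewrite n1' in n1.
Qed.

Lemma QZ_extend (A B : zmodType) (i : {additive A -> B}) (f : {additive A -> QZ}) :
  injective i -> exists g : {additive B -> QZ}, forall a, g (i a) = f a.
Proof.
move=> iinj.
pose S : set (B * QZ) := fun u => exists a, (i a, f a) = u.
have [|g gS] := @divisible_extend B QZ QZ_divisible S.
  split.
  - by exists 0; rewrite !raddf0.
  - by move=> _ _ [a <-] [b <-]; exists (a - b); rewrite !raddfB.
  - by move=> d [a [ia0 <-]]; rewrite (iinj a 0) ?raddf0.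
by exists g => a; apply: gS; exists a.
Qed.

Lemma QZ_cogenerates (A : zmodType) (x : A) : x != 0 ->
  exists f : {additive A -> QZ}, f x != 0.
Proof.
move=> x0.
have [q [q0 qx]] : exists q : QZ, q != 0 /\ forall k : int, x *~ k = 0 -> q *~ k = 0.
  pose Q n := (0 < n)%N && (x *+ n == 0).
  have [exQ|noQ] := pselect (exists n, Q n); last first.
    have [q [q0 _]] := @QZ_order 2 isT.
    exists q; split=> // k xk; suff -> : k = 0 by rewrite mulr0z.
    apply/eqP/negPn/negP => kn0; apply: noQ; exists `|k|%N.
    rewrite /Q absz_gt0 kn0 /= pmulrn abszE.
    have [k0|k0] := ger0P k; first by rewrite xk.
    by rewrite mulrNz xk oppr0.
  case: (ex_minnP exQ) => d /andP[d0 /eqP xd] dmin.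
  have d1 : (1 < d)%N.
    rewrite ltn_neqAle d0 andbT eq_sym; apply: contraNneq x0 => d1.
    by rewrite -[x]mulr1n -d1 xd.
  have [q [q0 qd]] := QZ_order d1; exists q; split=> // k xk.
  have dn0 : d%:Z != 0 by rewrite eqz_nat -lt0n.
  have xr : x *~ (k %% d%:Z)%Z = 0.
    have -> : (k %% d%:Z)%Z = k - d%:Z * (k %/ d%:Z)%Z by rewrite /modz mulrC.
    by rewrite mulrzBr xk mulrzA -pmulrn xd mul0rz subr0.
  have r0 : (k %% d%:Z)%Z = 0.
    have rge : 0 <= (k %% d%:Z)%Z by apply: modz_ge0.
    have rlt : (k %% d%:Z)%Z < d%:Z by rewrite ltz_pmod // ltz_nat.
    case E : (k %% d%:Z)%Z rge rlt => [n|//] _; rewrite ltz_nat => nd.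
    have [n0|n0] := posnP n; first by rewrite n0.
    suff /dmin : Q n by rewrite leqNgt nd.
    by rewrite /Q n0 pmulrn -E xr eqxx.
  by rewrite (divz_eq k d%:Z) r0 addr0 mulrC mulrzA -pmulrn qd mul0rz.
pose S : set (A * QZ) := fun u => exists k : int, (x *~ k, q *~ k) = u.
have [|g gS] := @divisible_extend A QZ QZ_divisible S.
  split.
  - by exists 0; rewrite !mulr0z.
  - by move=> _ _ [k <-] [l <-]; exists (k - l); rewrite !mulrzBr.
  - by move=> d [k [xk <-]]; apply: qx.
by exists g; rewrite (gS x q) //; exists 1.
Qed.

Section InjectiveFunctors.
Variable R : pzRingType.

Definition modR_rep (M : modR R) : functor (modR R) Ab.
Proof.
refine (@Functor (modR R) Ab (fun N => lhom (sval M) (sval N) : zmodType)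
  (fun N P g => @lhom_post R^c (sval M) _ _ g) _ _ _).
- by move=> N; apply: additive_eq => f; apply: linear_eq.
- by move=> N P Q g f; apply: additive_eq => h; apply: linear_eq.
- by move=> N P f g; apply: additive_eq => h; apply: linear_eq.
Defined.

Lemma modR_yoneda (G : functor (modR R) Ab) (M : modR R) (x : G M) :
  exists s : nattrans (modR_rep M) G, s M (idm M) = x.
Proof.
have fxD (N : modR R) : {morph (fun f : modR_rep M N => fmap G (f : hom M N) x) : f g / f + g}.
  move=> f g; exact: (congr1 (fun h : {additive _ -> _} => h x) (fmapD G f g)).
have nat_x (N P : modR R) (g : hom N P) :
    fmap G g ∘ (mk_additive (@fxD N) : @hom Ab (modR_rep M N) (G N)) =
    (mk_additive (@fxD P) : @hom Ab (modR_rep M P) (G P)) ∘ fmap (modR_rep M) g.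
  apply: additive_eq => f; symmetry.
  exact: (congr1 (fun h : {additive _ -> _} => h x) (fmapM G g f)).
exists (NatTrans nat_x) => /=.
exact: (congr1 (fun h : {additive _ -> _} => h x) (fmap1 G M)).
Qed.

Lemma monic_injective (F G : functor (modR R) Ab) (s : nattrans F G) :
  @monic (funcat (modR R) Ab) F G s -> forall M, injective (s M).
Proof.
move=> smono M; apply: raddf_inj => x sx0.
have [t tx] := modR_yoneda x.
suff t0 : t = nt_zero _ _ by rewrite -tx t0.
apply: smono; apply: nattrans_eq => N; apply: additive_eq => f /=.
rewrite raddf0 (_ : f = fmap (modR_rep M) f (idm M)); last exact: linear_eq.
by rewrite -ntr_natural tx -ntr_natural sx0 raddf0.
Qed.

Lemma injective_monic (F G : functor (modR R) Ab) (s : nattrans F G) :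
  (forall M, injective (s M)) -> @monic (funcat (modR R) Ab) F G s.
Proof.
move=> sinj H u v uv; apply: nattrans_eq => M; apply: additive_eq => x.
apply: sinj.
exact: (congr1 (fun w : nattrans H G => (w M : {additive _ -> _}) x) uv).
Qed.

(* the product over j of the functors M |-> Hom_Z((M, N j), Q/Z) *)
Section Inj.
Variables (J : Type) (N : J -> modR R).

Definition inj_val (M : modR R) : Type :=
  forall j : J, ahom (lhom (sval M) (sval (N j))) QZ.

Section InjVal.
Variable M : modR R.
Implicit Types a b c : inj_val M.
Definition inj_add a b : inj_val M := fun j => a j + b j.
Definition inj_opp a : inj_val M := fun j => - a j.
Definition inj_zero : inj_val M := fun j => 0.
Lemma inj_addA : associative inj_add.
Proof. by move=> a b c; apply: functional_extensionality_dep => j; apply: addrA. Qed.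
Lemma inj_addC : commutative inj_add.
Proof. by move=> a b; apply: functional_extensionality_dep => j; apply: addrC. Qed.
Lemma inj_add0 : left_id inj_zero inj_add.
Proof. by move=> a; apply: functional_extensionality_dep => j; apply: add0r. Qed.
Lemma inj_addN : left_inverse inj_zero inj_opp inj_add.
Proof. by move=> a; apply: functional_extensionality_dep => j; apply: addNr. Qed.
HB.instance Definition _ := gen_eqMixin (inj_val M).
HB.instance Definition _ := gen_choiceMixin (inj_val M).
HB.instance Definition _ := GRing.isZmodule.Build (inj_val M)
  inj_addA inj_addC inj_add0 inj_addN.
End InjVal.

Lemma inj_val_eq (M : modR R) (a b : inj_val M) :
  (forall j f, a j f = b j f) -> a = b.
Proof.
move=> ab; apply: functional_extensionality_dep => j.
exact: additive_eq (ab j).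
Qed.

Definition inj_map (M P : modR R) (g : hom M P) : {additive inj_val M -> inj_val P}.
Proof.
apply: (@mk_additive (inj_val M) (inj_val P)
  (fun a j => (a j : {additive _ -> _}) \o @lhom_pre R^c _ _ (sval (N j)) g)).
by move=> a b; apply: inj_val_eq.
Defined.

Definition inj_fun : functor (modR R) Ab.
Proof.
refine (@Functor (modR R) Ab (fun M => inj_val M : zmodType) inj_map _ _ _).
- move=> M; apply: additive_eq => a; apply: inj_val_eq => j f.
  by congr (a j _); apply: linear_eq.
- move=> M P Q g f; apply: additive_eq => a; apply: inj_val_eq => j h.
  by congr (a j _); apply: linear_eq.
- move=> M P f g; apply: additive_eq => a; apply: inj_val_eq => j h.
  rewrite -[RHS](raddfD (a j)); congr (a j _); apply: linear_eq => x.
  exact: raddfD.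
Defined.

Section Extend.
Variables (G F : functor (modR R) Ab) (e : nattrans G F) (g : nattrans G inj_fun).
Hypothesis einj : forall M, injective (e M).

Definition inj_component (j : J) (x : G (N j)) : QZ :=
  (g (N j) x : inj_val (N j)) j (idm (N j)).

Lemma inj_componentD j : {morph @inj_component j : x y / x + y}.
Proof. by move=> x y; rewrite /inj_component raddfD. Qed.

Lemma inj_component_extend j : exists h : {additive F (N j) -> QZ},
  forall x, h (e (N j) x) = inj_component x.
Proof.
exact: (@QZ_extend _ _ (e (N j)) (mk_additive (@inj_componentD j)) (@einj (N j))).
Qed.

Definition inj_ext j : {additive F (N j) -> QZ} :=
  sval (cid (inj_component_extend j)).

Lemma inj_extE j x : inj_ext j (e (N j) x) = inj_component x.
Proof. by rewrite /inj_ext; case: cid. Qed.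

Lemma inj_lift_subproof1 (M : modR R) (x : F M) j :
  {morph (fun f : lhom (sval M) (sval (N j)) =>
    inj_ext j (fmap F (f : hom M (N j)) x)) : f g / f + g}.
Proof.
move=> f f'; rewrite -raddfD; congr (inj_ext j _).
exact: (congr1 (fun h : {additive _ -> _} => h x) (fmapD F (f : hom M (N j)) f')).
Qed.

Lemma inj_lift_subproof2 (M : modR R) :
  {morph ((fun x j => mk_additive (@inj_lift_subproof1 M x j)) : F M -> inj_val M) :
    x y / x + y}.
Proof.
by move=> x y; apply: inj_val_eq => j f; rewrite /= !raddfD.
Qed.

Definition inj_lift : nattrans F inj_fun.
Proof.
exists (fun M => @mk_additive (F M) (inj_val M) _ (@inj_lift_subproof2 M)).
move=> M P f; apply: additive_eq => x; apply: inj_val_eq => j h /=.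
congr (inj_ext j _).
exact: (congr1 (fun h : {additive _ -> _} => h x) (fmapM F (h : hom P (N j)) f)).
Defined.

Lemma inj_liftE : nt_cmp inj_lift e = g.
Proof.
apply: nattrans_eq => M; apply: additive_eq => x; apply: inj_val_eq => j f /=.
rewrite ntr_natural inj_extE /inj_component -ntr_natural.
apply: (congr1 (fun h => ((g M x : inj_val M) j : {additive _ -> _}) h)).
exact: linear_eq.
Qed.
End Extend.

Lemma inj_funP : @projective (opcat (funcat (modR R) Ab)) inj_fun.
Proof.
move=> F G e emono g.
have einj : forall M, injective ((e : nattrans G F) M) by apply: monic_injective.
by exists (inj_lift g einj); apply: inj_liftE.
Qed.
End Inj.

(* finite presentations, a set of representatives of the isomorphism classes
   of finitely presented modules *)
Definition presentation : Type :=
  {mn : nat * nat & {linear 'rV[R^c]_(mn.1) -> 'rV[R^c]_(mn.2)}}.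

Definition presents (s : presentation) (M : LMod R^c) : Prop :=
  exists p : {linear 'rV[R^c]_((projT1 s).2) -> M},
    (forall x, exists v, p v = x) /\
    (forall v, p v = 0 <-> exists u, projT2 s u = v).

Definition presented (s : presentation) : modR R :=
  if pselect (exists M : modR R, presents s (sval M)) is left ex
  then sval (cid ex) else RR R.

Lemma presents_map s (M N : LMod R^c) : presents s M -> presents s N ->
  exists (f : {linear M -> N}) (g : {linear N -> M}), forall x, g (f x) = x.
Proof.
move=> [p [psurj pker]] [q [qsurj qker]].
have key (M1 M2 : LMod R^c) (p1 : {linear 'rV[R^c]_((projT1 s).2) -> M1})
    (p2 : {linear 'rV[R^c]_((projT1 s).2) -> M2}) :
    (forall x, exists v, p1 v = x) ->
    (forall v, p1 v = 0 -> p2 v = 0) ->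
    exists f : {linear M1 -> M2}, forall v, f (p1 v) = p2 v.
  move=> surj ker.
  pose f x := p2 (sval (cid (surj x))).
  have fE v : f (p1 v) = p2 v.
    rewrite /f; case: cid => w /= wv.
    apply/eqP; rewrite -subr_eq0 -raddfB; apply/eqP/ker.
    by rewrite linearB /= wv subrr.
  have fD : {morph f : x y / x + y}.
    move=> x y; have [[v <-] [w <-]] := (surj x, surj y).
    by rewrite -raddfD !fE raddfD.
  have fZ a : {morph f : x / a *: x}.
    by move=> x; have [v <-] := surj x; rewrite -linearZ !fE linearZ.
  by exists (mk_linear fD fZ) => v; apply: fE.
have [f fE] := key _ _ p q psurj (fun v pv => (qker v).2 ((pker v).1 pv)).
have [g gE] := key _ _ q p qsurj (fun v qv => (pker v).2 ((qker v).1 qv)).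
by exists f, g => x; have [v <-] := psurj x; rewrite fE gE.
Qed.

Lemma presented_retract (M : modR R) : exists (s : presentation)
  (f : hom M (presented s)) (g : hom (presented s) M), g ∘ f = idm M.
Proof.
have [m [n [a [p pP]]]] := svalP M.
pose s : presentation := existT _ (m, n) a.
have sM : presents s (sval M) by exists p.
have sN : presents s (sval (presented s)).
  rewrite /presented; case: pselect => [ex|[]]; first by case: cid.
  by exists M.
have [f [g gf]] := presents_map sM sN.
by exists s, f, g; apply: linear_eq.
Qed.

Section Embedding.
Variable G : functor (modR R) Ab.

Definition env_index : Type := {s : presentation & ahom (G (presented s)) QZ}.

Definition env : functor (modR R) Ab :=
  inj_fun (fun j : env_index => presented (projT1 j)).

Definition env_val (M : modR R) (x : G M) (j : env_index)
    (f : lhom (sval M) (sval (presented (projT1 j)))) : QZ :=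
  projT2 j (fmap G (f : hom M (presented (projT1 j))) x).

Lemma env_valD (M : modR R) (x : G M) j : {morph @env_val M x j : f g / f + g}.
Proof.
move=> f g; rewrite /env_val -raddfD; congr (projT2 j _).
exact: (congr1 (fun h : {additive _ -> _} => h x)
  (fmapD G (f : hom M (presented (projT1 j))) g)).
Qed.

Lemma env_mapD (M : modR R) :
  {morph ((fun x j => mk_additive (@env_valD M x j)) : G M -> env M) :
    x y / x + y}.
Proof.
by move=> x y; apply: inj_val_eq => j f; rewrite /= /env_val !raddfD.
Qed.

Definition env_map : nattrans G env.
Proof.
exists (fun M => @mk_additive (G M) (env M) _ (@env_mapD M)).
move=> M P f; apply: additive_eq => x; apply: inj_val_eq => j h /=.
rewrite /env_val /=; congr (projT2 j _).
exact: (congr1 (fun h : {additive _ -> _} => h x)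
  (fmapM G (h : hom P (presented (projT1 j))) f)).
Defined.

Lemma env_map_inj M : injective (env_map M).
Proof.
apply: raddf_inj => x x0; apply/eqP/negPn/negP => xn0.
have [s [f [g gf]]] := presented_retract M.
have fx0 : fmap G f x != 0.
  apply: contraNneq xn0 => fx0.
  have -> : x = fmap G g (fmap G f x).
    have := congr1 (fun h : {additive _ -> _} => h x) (fmapM G g f).
    by rewrite gf fmap1.
  by rewrite fx0 raddf0.
have [h hx] := QZ_cogenerates fx0.
move/negP: hx; apply; apply/eqP.
exact: (congr1 (fun a : env M =>
  (a : inj_val _ M) (existT _ s h) f) x0).
Qed.
End Embedding.

Definition functor_proj_presentation (G : opcat (funcat (modR R) Ab)) :
  proj_presentation G.
Proof.
pose Q := fcoker (env_map G).
apply: (@ProjPresentation (opcat (funcat (modR R) Ab)) G (env Q) (env G)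
  (nt_cmp (env_map Q) (fcoker_pr (env_map G))) (env_map G)).
- exact: inj_funP.
- exact: inj_funP.
- exists Q, (fcoker_pr (env_map G)), (env_map Q); split=> //.
    exact: (fcoker_prP (env_map G)).
  by apply: injective_monic; apply: env_map_inj.
- by apply: injective_monic; apply: env_map_inj.
Defined.

End InjectiveFunctors.

(* D_L = L_0 (Y ∘ ev^op).  A projective presentation of G in (mod-R, Ab)^op is
   an exact sequence 0 -> G -> I0 -> I1 in (mod-R, Ab) with I0 and I1 injective,
   and D_L G is the cokernel of (I1(R), -) -> (I0(R), -). *)
Section DL.
Variable R : pzRingType.

Definition yoneda_ev : functor (opcat (funcat (modR R) Ab)) (fp R) :=
  compf (yoneda R) (opfunctor (ev R)).

Definition yoneda_ev_coker (G H : opcat (funcat (modR R) Ab)) (s : hom G H) :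
    cokernel (fmap yoneda_ev s) :=
  rep_coker (fmap yoneda_ev s).

Definition DL : functor (opcat (funcat (modR R) Ab)) (fp R) :=
  L0 (@functor_proj_presentation R) yoneda_ev_coker.
End DL.

(* Main.v *)
Require Import Defs.
From mathcomp Require Import all_boot all_algebra.
From mathcomp Require Import boolp.
Import Defs.

(** Evaluation at the ring has a left adjoint, X |-> - ⊗ X: since M = Hom(R, M)
    for every right module M, a linear map phi : X -> I(R) extends in a unique
    way to - ⊗ X -> I, by m ⊗ x |-> I(m)(phi x) where m : R -> M is
    multiplication of m by scalars ([transpose], [transpose_ex],
    [transpose_inj]).  In particular there is a counit - ⊗ I(R) -> I.

    The counit pairs an element x of F(I(R)) with a transformation
    t : F -> M ⊗ -, an element of (D_A F)M: send t_{I(R)}(x), which lies in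
    M ⊗ I(R), to I(M).  This is a homomorphism F(I(R)) -> (D_A F, I), natural in
    F and I ([pairing], [pairing_post], [pairing_pre]).  For injective I it is
    bijective ([pairing_inj], [pairing_surj]).  Indeed, present F as the
    cokernel of (f,-) : (Y,-) -> (X,-); then D_A F is the kernel of
    - ⊗ f : - ⊗ X -> - ⊗ Y, and applying the exact functor (-, I) together
    with the adjunction turns (D_A F, I) into the cokernel of
    (Y, I(R)) -> (X, I(R)), which is F(I(R)).

    Let 0 -> G -> I0 -> I1 be exact with I0 and I1 injective, so that D_L G is
    the cokernel of (I1(R),-) -> (I0(R),-).  By the Yoneda lemma (D_L G, F) is
    the kernel of F(I0(R)) -> F(I1(R)) ([DL_val_inj], [DL_val_ker],
    [DL_val_ex]).  By left exactness (D_A F, G) is the kernel of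
    (D_A F, I0) -> (D_A F, I1), which the pairing identifies with the former. *)

Set Implicit Arguments.
Unset Strict Implicit.
Unset Printing Implicit Defensive.

Import GRing.Theory.
Local Open Scope ring_scope.

(** * Natural transformations and functors to abelian groups *)

Section NatTransCmp.
Variables C D : preadditive.
Implicit Types F G H K : functor C D.

(** These three are laws of the functor category, restated for [nt_cmp] so that
    rewriting finds them syntactically, without unfolding the functors. *)
Lemma nt_cmpA F G H K (u : nattrans H K) (t : nattrans G H)
    (s : nattrans F G) :
  nt_cmp u (nt_cmp t s) = nt_cmp (nt_cmp u t) s.
Proof. exact: (@cmpA (funcat C D)). Qed.

Lemma nt_cmp0 F G H (s : nattrans F G) :
  nt_cmp (nt_zero G H) s = nt_zero F H.
Proof. exact: (@cmp0m (funcat C D)). Qed.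

Lemma nt_cmpD F G H (u : nattrans G H) (s t : nattrans F G) :
  nt_cmp u (nt_add s t) = nt_add (nt_cmp u s) (nt_cmp u t).
Proof. exact: (@cmpDr (funcat C D)). Qed.
End NatTransCmp.

Lemma fmap_cmpE (C : preadditive) (G : functor C Ab) (M N P : C)
    (g : hom N P) (f : hom M N) x :
  fmap G (g ∘ f) x = fmap G g (fmap G f x).
Proof. by rewrite fmapM. Qed.

Lemma factor_through_injective (C : preadditive) (A B T : functor C Ab)
    (i : nattrans A B) (t : nattrans T B) :
  (forall M, injective (i M)) -> (forall M x, exists y, i M y = t M x) ->
  exists w : nattrans T A, nt_cmp i w = t.
Proof.
move=> iinj im.
pose w M x := sval (cid (im M x)).
have wE M x : i M (w M x) = t M x by rewrite /w; case: cid.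
have wD M : {morph w M : x y / x + y}.
  by move=> x y; apply: (iinj M); rewrite raddfD !wE raddfD.
have wnat (M N : C) (f : hom M N) :
    fmap A f ∘ (mk_additive (@wD M) : @hom Ab (T M) (A M)) =
    (mk_additive (@wD N) : @hom Ab (T N) (A N)) ∘ fmap T f.
  apply: additive_eq => x; apply: (iinj N).
  by rewrite /= -ntr_natural !wE ntr_natural.
exists (NatTrans wnat); apply: nattrans_eq => M.
by apply: additive_eq => x; apply: wE.
Qed.

(** * The left adjoint of evaluation at the ring *)

Section EvaluationAdjunction.
Variable R : pzRingType.

Definition elt_map (M : modR R) (m : sval M) : @hom (modR R) (RR R) M.
Proof.
apply: (@mk_linear R^c R^c^o (sval M) (fun a : R^c => a *: m)).
- by move=> a b; rewrite scalerDl.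
- by move=> a b; rewrite -scalerA.
Defined.

Lemma elt_map_post (M N : modR R) (f : hom M N) (m : sval M) :
  f ∘ elt_map m = elt_map ((f : {linear _ -> _}) m).
Proof. by apply: linear_eq => a; rewrite /= linearZ. Qed.

Lemma elt_map_lmul (M : modR R) (m : sval M) (r : R) :
  elt_map m ∘ lmul r = elt_map ((r : R^c) *: m).
Proof. by apply: linear_eq => a; rewrite /= scalerA. Qed.

Lemma elt_mapD (M : modR R) (m m' : sval M) :
  elt_map (m + m') = hadd (elt_map m) (elt_map m').
Proof. by apply: linear_eq => a; apply: scalerDr. Qed.

Definition tensorl (X : LMod R) : functor (modR R) Ab.
Proof.
refine (@Functor (modR R) Ab (fun M => tensor (sval M) X)
  (fun M N f => tensor_map f idfun) _ _ _).
- by move=> M; apply: tensor_ext => m x; rewrite tensor_mapE.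
- by move=> M N P g f; apply: tensor_ext => m x; rewrite /= !tensor_mapE.
- by move=> M N f g; apply: tensor_ext => m x; rewrite /= !tensor_mapE pureDl.
Defined.

Definition tensorl_map (X Y : LMod R) (f : hom X Y) :
  nattrans (tensorl X) (tensorl Y).
Proof.
exists (fun M => tensor_map idfun (f : {linear X -> Y})) => M N k.
by apply: tensor_ext => m x; rewrite /= !tensor_mapE.
Defined.

Section Transpose.
Variables (X : LMod R) (I : functor (modR R) Ab) (phi : {linear X -> ev_ob I}).

Definition transpose_at (M : modR R) : {additive tensor (sval M) X -> I M}.
Proof.
apply: (@tensor_lift R (sval M) X (I M)
  (fun m x => fmap I (elt_map m) (phi x))).
- by move=> m m' x; rewrite elt_mapD fmapD.
- by move=> m x x'; rewrite !raddfD.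
- by move=> r m x; rewrite linearZ -elt_map_lmul fmap_cmpE.
Defined.

Lemma transpose_atE (M : modR R) m x :
  @transpose_at M (pure m x) = fmap I (elt_map m) (phi x).
Proof. exact: tensor_liftE. Qed.

Definition transpose : nattrans (tensorl X) I.
Proof.
exists transpose_at => M N f; apply: tensor_ext => m x.
by rewrite /= tensor_mapE !transpose_atE -fmap_cmpE elt_map_post.
Defined.
End Transpose.

(** The map X -> I(R) is recovered as x |-> t_R(1 ⊗ x); naturality of t along
    m : R -> M then determines t on every m ⊗ x. *)
Lemma transpose_ex (X : LMod R) (I : functor (modR R) Ab)
    (t : nattrans (tensorl X) I) :
  exists phi : {linear X -> ev_ob I}, t = transpose phi.
Proof.
pose f (x : X) : ev_ob I := t (RR R) (pure (1 : R^c^o) x).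
have fD : {morph f : x y / x + y} by move=> x y; rewrite /f pureDr raddfD.
have fZ a : {morph f : x / a *: x}.
  move=> x; rewrite /f -pureZ.
  rewrite -[RHS]/(fmap I (lmul a) (t (RR R) (pure (1 : R^c^o) x))).
  rewrite ntr_natural /= tensor_mapE; congr (t _ (pure _ _)).
  by rewrite /= mul1r; exact: mulr1.
exists (mk_linear fD fZ); apply: nattrans_eq => M.
apply: tensor_ext => m x; rewrite transpose_atE /= /f ntr_natural /=.
by rewrite tensor_mapE /= scale1r.
Qed.

Lemma transpose_inj (X : LMod R) (I : functor (modR R) Ab)
    (phi psi : {linear X -> ev_ob I}) :
  transpose phi = transpose psi -> phi = psi.
Proof.
move=> e; apply: linear_eq => x.
have E (chi : {linear X -> ev_ob I}) :
    chi x = transpose chi (RR R) (pure (1 : R^c^o) x).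
  rewrite transpose_atE -[LHS]/(idm (I (RR R)) (chi x)) -fmap1.
  by congr (fmap I _ _); apply: linear_eq => a; symmetry; exact: mulr1.
by rewrite (E phi) e -E.
Qed.

Lemma transpose_pre (X Y : LMod R) (I : functor (modR R) Ab)
    (f : {linear X -> Y}) (phi : {linear Y -> ev_ob I}) (M : modR R) t :
  transpose phi M (tensor_map idfun f t) = transpose (phi \o f) M t.
Proof.
pose u : {additive _ -> _} :=
  transpose_at phi M \o @tensor_map R _ _ _ _ idfun f.
suff e : u = transpose_at (phi \o f) M by rewrite -[LHS]/(u t) e.
by apply: tensor_ext => m x; rewrite /u /= tensor_mapE !transpose_atE.
Qed.

Lemma transpose_post (X : LMod R) (I J : functor (modR R) Ab)
    (phi : {linear X -> ev_ob I}) (d : nattrans I J) (M : modR R) t :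
  d M (transpose phi M t) = transpose (ev_map d \o phi) M t.
Proof.
pose u : {additive _ -> _} := (d M : {additive _ -> _}) \o transpose_at phi M.
suff e : u = transpose_at (ev_map d \o phi) M by rewrite -[LHS]/(u t) e.
by apply: tensor_ext => m x; rewrite /u /= !transpose_atE /= ntr_natural.
Qed.

Definition counit (I : functor (modR R) Ab) : nattrans (tensorl (ev R I)) I :=
  transpose idfun.
End EvaluationAdjunction.

(** * Injective functors *)

Section Injective.
Variables (R : pzRingType) (I : functor (modR R) Ab).
Hypothesis Iinj : @projective (opcat (funcat (modR R) Ab)) I.

Lemma injective_extend (A B : functor (modR R) Ab) (i : nattrans A B)
    (g : nattrans A I) : (forall M, injective (i M)) ->
  exists k : nattrans B I, nt_cmp k i = g.
Proof. by move=> /injective_monic imono; apply: (Iinj imono). Qed.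

(** Exactness of (-, I): by exactness of K -> A -> B, the cokernel of K -> A
    embeds in B, and g factors through it, so g extends to B. *)
Lemma injective_exact (K A B : functor (modR R) Ab) (i : nattrans K A)
    (u : nattrans A B) (g : nattrans A I) :
  (forall M x, u M (i M x) = 0) ->
  (forall M x, u M x = 0 -> exists y, i M y = x) ->
  nt_cmp g i = nt_zero K I -> exists k : nattrans B I, nt_cmp k u = g.
Proof.
move=> ui0 exu gi0.
have [_ univ] := fcoker_prP i.
have [v [vE _]] :
    exists! v : nattrans (fcoker i) B, nt_cmp v (fcoker_pr i) = u.
  by apply: univ; apply: nattrans_eq => M; apply: additive_eq; apply: ui0.
have [g' [g'E _]] := univ _ g gi0.
have vinj M : injective (v M).
  apply: raddf_inj; elim/acoker_ind => y vy0; apply/acoker_pr_eq0/exu.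
  by rewrite -vE.
have [k kE] := injective_extend g' vinj.
by exists k; rewrite -g'E -kE -vE; apply: nt_cmpA.
Qed.
End Injective.

(** * Finitely presented functors by generators and relations *)

Section Presentation.
Variable R : pzRingType.

(** The exact sequence (Y,-) -> (X,-) -> F -> 0, encoded through the Yoneda
    lemma: e is the element of F(X) corresponding to (X,-) -> F, and the first
    map is composition with f. *)
Record fp_presentation (F : functor (LMod R) Ab) (X Y : LMod R)
    (f : hom X Y) (e : F X) : Prop := FpPresentation {
  fp_gen : forall (Z : LMod R) (z : F Z), exists g : hom X Z, fmap F g e = z;
  fp_rel : forall (Z : LMod R) (g : hom X Z),
    fmap F g e = 0 <-> exists h : hom Y Z, h ∘ f = g
}.

Lemma fp_presentation_ex (F : fp R) :
  exists (X Y : LMod R) (f : hom X Y) (e : (sval F : functor _ _) X),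
    fp_presentation f e.
Proof.
case: F => F1 [X [Y [a [p pP]]]] /=; pose F : functor (LMod R) Ab := F1.
have pE (Z : LMod R) (g : hom X Z) :
    fmap F g (p X (idm X : lhom X X)) = p Z g.
  by rewrite (ntr_natural p); congr (p Z _); apply: linear_eq.
have aE (Z : LMod R) (h : hom Y Z) :
    a Z h = h ∘ (a Y (idm Y : lhom Y Y) : hom X Y).
  rewrite -[RHS]/(fmap (rep X) h (a Y (idm Y : lhom Y Y))) (ntr_natural a).
  by congr (a Z _); apply: linear_eq.
exists X, Y, (a Y (idm Y : lhom Y Y)), (p X (idm X : lhom X X)); split.
  by move=> Z z; have [g <-] := (pP Z).1 z; exists g.
move=> Z g; rewrite pE; split=> [/(pP Z).2[h <-]|[h hg]].
  by exists h; rewrite -aE.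
by apply/(pP Z).2; exists h; rewrite aE.
Qed.

Section PresentedFunctor.
Variables (F : functor (LMod R) Ab) (X Y : LMod R) (f : hom X Y) (e : F X).
Hypothesis pres : fp_presentation f e.

Lemma fp_relation : fmap F f e = 0.
Proof. by apply/(fp_rel pres); exists (idm Y); apply: cmp1m. Qed.

Lemma fp_nattrans_eq (H : functor (LMod R) Ab) (s t : nattrans F H) :
  s X e = t X e -> s = t.
Proof.
move=> st; apply: nattrans_eq => Z; apply: additive_eq => z.
by have [g <-] := fp_gen pres z; rewrite -!ntr_natural st.
Qed.

(** The transformation sends F(g)(e) to H(g)(y); two choices of g for the same
    element differ by a map that factors through f, which H kills on y. *)
Lemma fp_nattrans_ex (H : functor (LMod R) Ab) (y : H X) :
  fmap H f y = 0 -> exists s : nattrans F H, s X e = y.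
Proof.
move=> fy0.
pose g Z (z : F Z) : hom X Z := sval (cid (fp_gen pres z)).
have gE Z z : fmap F (g Z z) e = z by rewrite /g; case: cid.
have wd Z (g1 g2 : hom X Z) : fmap F g1 e = fmap F g2 e ->
    fmap H g1 y = fmap H g2 y.
  move=> g12.
  have [|h hE] := (fp_rel pres (hadd g1 (hopp g2))).1.
    by rewrite fmapD fmapN /= g12 subrr.
  apply/eqP; rewrite -subr_eq0.
  rewrite -[_ - _]/((hadd (fmap H g1) (hopp (fmap H g2)) : {additive _ -> _}) y).
  by rewrite -fmapN -fmapD -hE fmap_cmpE fy0 raddf0.
pose s Z (z : F Z) := fmap H (g Z z) y.
have sE Z (k : hom X Z) : s Z (fmap F k e) = fmap H k y.
  by apply: wd; rewrite gE.
have sD Z : {morph s Z : x z / x + z}.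
  move=> x z; rewrite -{1}(gE Z x) -{1}(gE Z z).
  rewrite -[fmap F _ e + _]/((hadd (fmap F (g Z x)) (fmap F (g Z z))
    : {additive _ -> _}) e).
  by rewrite -fmapD sE fmapD.
have snat (Z W : LMod R) (k : hom Z W) :
    fmap H k ∘ (mk_additive (@sD Z) : @hom Ab (F Z) (H Z)) =
    (mk_additive (@sD W) : @hom Ab (F W) (H W)) ∘ fmap F k.
  by apply: additive_eq => z; rewrite /= -{2}(gE Z z) -fmap_cmpE sE fmap_cmpE.
exists (NatTrans snat) => /=.
have -> : e = fmap F (idm X) e by rewrite fmap1.
by rewrite sE fmap1.
Qed.
End PresentedFunctor.
End Presentation.

(** * The pairing of F(I(R)) with D_A F *)

Section Pairing.
Variables (R : pzRingType) (F : fp R).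
Let F0 : functor (LMod R) Ab := sval F.

Definition pairing (I : functor (modR R) Ab) (x : F0 (ev R I)) :
  nattrans (DA_ob F) I.
Proof.
unshelve refine (@NatTrans _ _ (DA_ob F) I (fun M => @mk_additive
  (small_nat F (tensorf (sval M))) (I M)
  (fun t => counit I M (of_small t (ev R I) x)) _) _).
- by move=> s t; rewrite of_smallD /= raddfD.
- move=> M N f; apply: additive_eq => t /=.
  by rewrite to_smallK; apply: (ntr_natural (counit I) f).
Defined.

Lemma pairingD (I : functor (modR R) Ab) (x y : F0 (ev R I)) :
  pairing (x + y) = nt_add (pairing x) (pairing y).
Proof.
by apply: nattrans_eq => M; apply: additive_eq => t; rewrite /= !raddfD.
Qed.

Lemma pairing0 (I : functor (modR R) Ab) :
  pairing (0 : F0 (ev R I)) = nt_zero (DA_ob F) I.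
Proof.
by apply: nattrans_eq => M; apply: additive_eq => t; rewrite /= !raddf0.
Qed.

Lemma pairing_post (I J : functor (modR R) Ab) (d : nattrans I J)
    (x : F0 (ev R I)) :
  pairing (fmap F0 (ev_map d) x) = nt_cmp d (pairing x).
Proof.
apply: nattrans_eq => M; apply: additive_eq => t /=.
rewrite transpose_post -ntr_natural /= transpose_pre.
by congr (transpose_at _ _ _); apply: linear_eq.
Qed.

Section Coordinates.
Variables (X Y : LMod R) (f : hom X Y) (e : F0 X).
Hypothesis pres : fp_presentation f e.

(** Evaluating at the generator e identifies D_A F with the kernel of
    - ⊗ f : - ⊗ X -> - ⊗ Y, by [DA_incl_inj], [tensorl_map_DA_incl] and
    [DA_incl_kernel]. *)
Definition DA_incl : nattrans (DA_ob F) (tensorl X).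
Proof.
unshelve refine (@NatTrans _ _ (DA_ob F) (tensorl X) (fun M => @mk_additive
  (small_nat F (tensorf (sval M))) (tensor (sval M) X)
  (fun t => of_small t X e) _) _).
- by move=> s t; rewrite of_smallD.
- by move=> M N k; apply: additive_eq => t; rewrite /= to_smallK.
Defined.

Lemma DA_incl_inj M : injective (DA_incl M).
Proof.
move=> s t st; apply: (can_inj (@of_smallK _ _ _)).
by apply: (fp_nattrans_eq pres); apply: st.
Qed.

Lemma tensorl_map_DA_incl (M : modR R) s : tensorl_map f M (DA_incl M s) = 0.
Proof.
rewrite -[LHS]/(fmap (tensorf (sval M)) f (of_small s X e)) ntr_natural.
by rewrite (fp_relation pres) raddf0.
Qed.

Lemma DA_incl_kernel (M : modR R) (t : tensor (sval M) X) :
  tensorl_map f M t = 0 -> exists s, DA_incl M s = t.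
Proof.
move=> t0; have [s sE] := fp_nattrans_ex pres (H := tensorf (sval M)) t0.
by exists (to_small s); rewrite /= to_smallK.
Qed.

(** Under this identification, pairing with the element F(g)(e) is the
    restriction to the kernel of the transpose of g. *)
Lemma pairing_transpose (I : functor (modR R) Ab) (g : hom X (ev R I)) :
  pairing (fmap F0 g e) = nt_cmp (transpose g) DA_incl.
Proof.
apply: nattrans_eq => M; apply: additive_eq => t /=.
rewrite -ntr_natural /= transpose_pre.
by congr (transpose_at _ _ _); apply: linear_eq.
Qed.
End Coordinates.

Section PairingInjective.
Variable I : functor (modR R) Ab.
Hypothesis Iinj : @projective (opcat (funcat (modR R) Ab)) I.

(** Write x = F(g)(e).  If the transpose - ⊗ X -> I of g vanishes on the kernel
    of - ⊗ f, then it factors through - ⊗ f by injectivity of I.  Hence g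
    factors through f, which is the relation that makes F(g)(e) zero. *)
Lemma pairing_eq0 (x : F0 (ev R I)) :
  pairing x = nt_zero (DA_ob F) I -> x = 0.
Proof.
have [X [Y [f [e pres]]]] := fp_presentation_ex F.
have [g <-] := fp_gen pres x; rewrite pairing_transpose => g0.
have [k kE] := injective_exact Iinj (tensorl_map_DA_incl pres)
  (DA_incl_kernel pres) g0.
have [h kh] := transpose_ex k.
apply/(fp_rel pres); exists h; apply: transpose_inj; rewrite -kE kh.
apply: nattrans_eq => M; apply: additive_eq => t.
by rewrite -[RHS]/(transpose h M (tensor_map idfun f t)) transpose_pre.
Qed.

Lemma pairing_inj : injective (@pairing I).
Proof.
move=> x y xy; apply/eqP; rewrite -subr_eq0; apply/eqP/pairing_eq0.
apply: (@haddI (funcat (modR R) Ab) _ _ (pairing y)).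
rewrite -[LHS]pairingD addrC subrK xy.
by rewrite [RHS](@haddC (funcat (modR R) Ab)) [RHS](@hadd0 (funcat (modR R) Ab)).
Qed.

(** A transformation on D_A F extends from the kernel of - ⊗ f to - ⊗ X, where
    it is a transpose. *)
Lemma pairing_surj (s : nattrans (DA_ob F) I) : exists x, pairing x = s.
Proof.
have [X [Y [f [e pres]]]] := fp_presentation_ex F.
have [k kE] := injective_extend Iinj s (DA_incl_inj pres).
have [g kg] := transpose_ex k.
by exists (fmap F0 g e); rewrite pairing_transpose -kg.
Qed.
End PairingInjective.
End Pairing.

Lemma pairing_pre (R : pzRingType) (F F' : fp R) (k : hom F F')
    (I : functor (modR R) Ab) (x : (sval F : functor _ _) (ev R I)) :
  pairing ((k : nattrans _ _) (ev R I) x) = nt_cmp (pairing x) (DA_map k).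
Proof.
by apply: nattrans_eq => M; apply: additive_eq => t; rewrite /= to_smallK.
Qed.

(** * Transformations out of D_L G *)

Section LeftDerivedYoneda.
Variable R : pzRingType.
Implicit Types (G : functor (modR R) Ab) (F : fp R).

Definition at_id (X : LMod R) F (s : hom (yoneda R X : fp R) F) :
    (sval F : functor _ _) X :=
  (s : nattrans (rep X) (sval F)) X (idm X : lhom X X).

Lemma at_idE (X : LMod R) F (s : hom (yoneda R X : fp R) F) (Z : LMod R)
    (g : hom X Z) :
  (s : nattrans (rep X) (sval F)) Z g = fmap (sval F : functor _ _) g (at_id s).
Proof.
rewrite /at_id (ntr_natural (s : nattrans (rep X) (sval F))).
by congr ((s : nattrans (rep X) (sval F)) Z _); apply: linear_eq.
Qed.

Lemma at_id_inj (X : LMod R) F : injective (@at_id X F).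
Proof.
move=> s t st; apply: nattrans_eq => Z; apply: additive_eq => g.
by rewrite [LHS]at_idE [RHS]at_idE st.
Qed.

Lemma at_id_ex (X : LMod R) F (y : (sval F : functor _ _) X) :
  exists s : hom (yoneda R X : fp R) F, at_id s = y.
Proof.
pose H : functor (LMod R) Ab := sval F.
have sD (Z : LMod R) :
    {morph (fun g : rep X Z => fmap H (g : hom X Z) y) : g h / g + h}.
  by move=> g h; exact: (congr1 (fun k : {additive _ -> _} => k y) (fmapD H g h)).
have snat (Z W : LMod R) (k : hom Z W) :
    fmap H k ∘ (mk_additive (@sD Z) : @hom Ab (rep X Z) (H Z)) =
    (mk_additive (@sD W) : @hom Ab (rep X W) (H W)) ∘ fmap (rep X) k.
  apply: additive_eq => g; symmetry.
  exact: (congr1 (fun t : {additive _ -> _} => t y) (fmapM H k g)).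
by exists (NatTrans snat); rewrite /at_id /= fmap1.
Qed.

Lemma at_id_pre (I J : functor (modR R) Ab) (d : nattrans I J) F
    (s : hom (yoneda_ev R I) F) :
  at_id (s ∘ fmap (yoneda_ev R) (d : @hom (opcat (funcat (modR R) Ab)) J I)) =
  fmap (sval F : functor _ _) (ev_map d)
    (at_id (s : hom (yoneda R (ev R I)) F)).
Proof.
rewrite -at_idE /at_id /=.
by congr ((s : nattrans (rep _) (sval F)) _ _); apply: linear_eq.
Qed.

Definition env_coker G : functor (modR R) Ab := fcoker (env_map G).

(** The differential of the copresentation 0 -> G -> env G -> env (env_coker G)
    by injectives from which D_L G is computed. *)
Definition env_d G : nattrans (env G) (env (env_coker G)) :=
  nt_cmp (env_map (env_coker G)) (fcoker_pr (env_map G)).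

Lemma env_d_env_map G : nt_cmp (env_d G) (env_map G) = nt_zero _ _.
Proof.
apply: nattrans_eq => M; apply: additive_eq => x.
rewrite -[LHS]/(env_map _ M (fcoker_pr (env_map G) M (env_map G M x))).
have -> : fcoker_pr (env_map G) M (env_map G M x) = 0.
  by apply/acoker_pr_eq0; exists x.
exact: raddf0.
Qed.

Lemma env_d_kernel G (M : modR R) x :
  env_d G M x = 0 -> exists y, env_map G M y = x.
Proof.
rewrite -(raddf0 (env_map (env_coker G) M)) => /env_map_inj.
by move/acoker_pr_eq0.
Qed.

Definition DL_pr G : @hom (fp R) (yoneda_ev R (env G)) (DL R G) :=
  L0_pr (@functor_proj_presentation R) (@yoneda_ev_coker R) G.

Lemma DL_prP G : is_cokernel (fmap (yoneda_ev R)
  (env_d G : @hom (opcat (funcat (modR R) Ab)) (env (env_coker G)) (env G)))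
  (DL_pr G).
Proof. exact: coker_prP. Qed.

(** The element of F(I0(R)) that corresponds by the Yoneda lemma to the
    composite (I0(R),-) -> D_L G -> F, where I0 = env G. *)
Definition DL_val G F (u : hom (DL R G) F) :
    (sval F : functor _ _) (ev R (env G)) :=
  at_id (u ∘ DL_pr G : hom (yoneda R (ev R (env G))) F).

Lemma DL_val_inj G F : injective (@DL_val G F).
Proof. by move=> u v /at_id_inj; apply: (is_cokernel_epic (DL_prP G)). Qed.

Lemma DL_val_ker G F (u : hom (DL R G) F) :
  fmap (sval F : functor _ _) (ev_map (env_d G)) (DL_val u) = 0.
Proof. by rewrite -[LHS]at_id_pre -cmpA (DL_prP G).1 cmpm0. Qed.

Lemma DL_val_ex G F (x : (sval F : functor _ _) (ev R (env G))) :
  fmap (sval F : functor _ _) (ev_map (env_d G)) x = 0 ->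
  exists u : hom (DL R G) F, DL_val u = x.
Proof.
move=> dx0; have [s sx] := at_id_ex x.
have [_ univ] := DL_prP G.
have [|u [uE _]] := univ F s; last by exists u; rewrite /DL_val -sx -uE.
by apply: at_id_inj; rewrite [LHS]at_id_pre sx dx0.
Qed.

Lemma DL_val_pre G G' F (h : nattrans G G') (h0 : nattrans (env G) (env G'))
    (u : hom (DL R G) F) :
  nt_cmp h0 (env_map G) = nt_cmp (env_map G') h ->
  DL_val (u ∘ fmap (DL R) (h : @hom (opcat (funcat (modR R) Ab)) G' G)) =
  fmap (sval F : functor _ _) (ev_map h0) (DL_val u).
Proof.
move=> hh0; rewrite -[RHS]at_id_pre /DL_val -[in RHS]cmpA -[in LHS]cmpA.
congr (at_id (u ∘ _)).
exact: (@L0_mapE _ _ _ (@functor_proj_presentation R) (@yoneda_ev_coker R)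
  G' G h h0 hh0).
Qed.
End LeftDerivedYoneda.

(** * The adjunction *)

Section Adjunction.
Variable R : pzRingType.
Implicit Types (G : functor (modR R) Ab) (F : fp R).

Lemma nt_cmp_env_map_inj T G (s t : nattrans T G) :
  nt_cmp (env_map G) s = nt_cmp (env_map G) t -> s = t.
Proof. exact: (injective_monic (@env_map_inj _ G)). Qed.

Lemma adj_ex G F (u : hom (DL R G) F) :
  exists w : nattrans (DA_ob F) G, nt_cmp (env_map G) w = pairing (DL_val u).
Proof.
apply: factor_through_injective; first exact: env_map_inj.
move=> M t; apply: env_d_kernel.
rewrite -[LHS]/(nt_cmp (env_d G) (pairing (DL_val u)) M t) -pairing_post.
by rewrite DL_val_ker pairing0.
Qed.

Definition adj G F (u : hom (DL R G) F) : nattrans (DA_ob F) G :=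
  sval (cid (adj_ex u)).

Lemma adjE G F (u : hom (DL R G) F) :
  nt_cmp (env_map G) (adj u) = pairing (DL_val u).
Proof. by rewrite /adj; case: cid. Qed.

Lemma adj_inj G F : injective (@adj G F).
Proof.
move=> u v uv; apply/DL_val_inj/(pairing_inj (@inj_funP _ _ _)).
by rewrite -!adjE uv.
Qed.

Lemma adj_surj G F (w : nattrans (DA_ob F) G) : exists u, adj u = w.
Proof.
have [x xw] := pairing_surj (@inj_funP _ _ _) (nt_cmp (env_map G) w).
have [|u ux] := @DL_val_ex _ G F x.
  (* injectivity of the pairing for the second term of the copresentation *)
  apply: (pairing_eq0 (@inj_funP _ _ _)).
  by rewrite pairing_post xw nt_cmpA env_d_env_map nt_cmp0.
by exists u; apply: nt_cmp_env_map_inj; rewrite adjE ux.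
Qed.
End Adjunction.

Theorem theorem4p3 (R : pzRingType) : left_adjoint (DL R) (DA R).
Proof.
exists (fun G F u => adj u); split.
- move=> G F; exists (fun w => sval (cid (adj_surj w))).
    by move=> u; apply: adj_inj; case: cid.
  by move=> w; case: cid.
- move=> G F u v; apply: nt_cmp_env_map_inj; rewrite adjE.
  by rewrite nt_cmpD !adjE -pairingD.
- move=> G G' F h u; apply: nt_cmp_env_map_inj; rewrite adjE.
  have [h0 hh0] := inj_funP (@injective_monic _ _ _ _ (@env_map_inj _ G))
    (nt_cmp (env_map G') h).
  rewrite (DL_val_pre _ hh0) pairing_post -adjE.
  by rewrite nt_cmpA [X in nt_cmp X _]hh0 -nt_cmpA.
- move=> G F F' k u; apply: nt_cmp_env_map_inj; rewrite adjE.
  by rewrite [LHS](pairing_pre k (DL_val u)) -adjE -nt_cmpA.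
Qed.
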